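(* Let $K$ be a field of characteristic $p>0$ and let $M$ be a nonzero holonomic finitely presented $\mathcal D(P_n)$-module. Then its multiplicity $e(M)$ is a natural number.
   Context: $P_n=K[x_1,\dots,x_n]$, $n\ge1$; $\mathcal D(P_n)$ is the ring of $K$-linear differential operators on $P_n$; modules are left modules. For $j\ge0$ let $\partial_i^{[j]}=\frac{\partial_i^j}{j!}$ be the operator $x^\alpha\mapsto\binom{\alpha_i}{j}x^{\alpha-je_i}$ (zero if $j>\alpha_i$), $\partial^{[\beta]}=\prod_i\partial_i^{[\beta_i]}$. Then $\mathcal D(P_n)=\bigoplus_{\alpha,\beta\in\mathbb N^n}Kx^\alpha\partial^{[\beta]}$; $F_i=\bigoplus_{|\alpha|+|\beta|\le i}Kx^\alpha\partial^{[\beta]}$ is the canonical filtration. A nonzero finitely generated module $M=\mathcal D(P_n)M_0$ ($\dim_KM_0<\infty$) is holonomic if there is a polynomial $q\in\mathbb Q[t]$ of degree $n$ with $\dim_K(F_iM_0)\le q(i)$ for $i\gg0$ (independent of $M_0$). For a holonomic finitely presented $M$ one has $\dim_K(F_iM_0)=\frac{e(M)}{n!}i^n+o(i^n)$ for a number $e(M)$ independent of $M_0$, called the multiplicity of $M$. *)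

(* Defs.v *)
From HB Require Import structures.
From mathcomp Require Import all_boot all_order all_algebra.
(* The notations of mpoly clash with those of mathcomp-analysis. *)
From mathcomp Require Import -(notations) ssrcomplements mpoly.
From mathcomp Require Import lra.
From mathcomp Require Import boolp classical_sets reals topology normedtype.
From mathcomp Require Import landau sequences.
Import Order.TTheory GRing.Theory Num.Theory numFieldNormedType.Exports.

Set Implicit Arguments.
Unset Strict Implicit.
Unset Printing Implicit Defensive.

Local Open Scope classical_set_scope.
Local Open Scope ring_scope.

Section DifferentialOperators.
Context (K : fieldType) (n : nat).
Local Notation P := (mpoly n K).
Implicit Types (u v : P -> P) (r s f : P).

(* diffop_lt d u, for a K-linear u, says that u has order at most d - 1 in
   Grothendieck's filtration: D_{-1} = 0 and u \in D_i iff [r, u] \in D_{i-1}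
   for every r in P. *)
Fixpoint diffop_lt (d : nat) (u : P -> P) : Prop :=
  match d with
  | 0 => forall f, u f = 0
  | e.+1 => forall r, diffop_lt e (fun f => r * u f - u (r * f))
  end.

Definition is_diffop (u : P -> P) : Prop :=
  linear u /\ exists d, diffop_lt d u.

Record diffop := Diffop {
  diffop_fun :> P -> P;
  diffop_prop : is_diffop diffop_fun }.

Lemma diffopP (u v : diffop) : (forall f, u f = v f) -> u = v.
Proof.
case: u v => [u hu] [v hv] /= /funext uv; subst v.
by congr Diffop; exact: Prop_irrelevance.
Qed.

Lemma diffop_linear (u : diffop) : linear u.
Proof. by case: (diffop_prop u). Qed.

Lemma lin0 u : linear u -> u 0 = 0.
Proof. by move=> hu; have := hu (-1) 0 0; rewrite scaler0 addr0 scaleN1r addNr. Qed.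

Lemma linB u : linear u -> forall f g, u (f - g) = u f - u g.
Proof. by move=> hu f g; rewrite addrC -scaleN1r hu scaleN1r addrC. Qed.

Lemma linZ u : linear u -> forall c f, u (c *: f) = c *: u f.
Proof. by move=> hu c f; rewrite -[_ *: f]addr0 hu lin0 // addr0. Qed.

Lemma linear_comm u r : linear u -> linear (fun f => r * u f - u (r * f)).
Proof.
move=> hu c f g /=; rewrite hu !mulrDr -!scalerAr hu scalerBr opprD.
by rewrite addrACA.
Qed.

Lemma diffop_lt0 d : diffop_lt d (fun=> 0).
Proof.
elim: d => [|d IH] //= r.
by rewrite (_ : (fun _ => _) = (fun=> 0)) //; apply: funext => f; rewrite mulr0 subr0.
Qed.

Lemma diffop_ltS d u : linear u -> diffop_lt d u -> diffop_lt d.+1 u.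
Proof.
elim: d u => [|d IH] u hu hd r; last by apply: IH; [exact: linear_comm|exact: hd].
by move=> f; rewrite !hd mulr0 subr0.
Qed.

Lemma diffop_ltW d e u : linear u -> (d <= e)%N -> diffop_lt d u -> diffop_lt e u.
Proof.
move=> hu /subnK <- hd; elim: (e - d)%N => [|k IH] //.
by rewrite addSn; exact: diffop_ltS.
Qed.

Lemma diffop_ltZD d c u v : diffop_lt d u -> diffop_lt d v ->
  diffop_lt d (fun f => c *: u f + v f).
Proof.
elim: d u v => [|d IH] u v /= hu hv; first by move=> f; rewrite hu hv scaler0 addr0.
move=> r; have := IH _ _ (hu r) (hv r); congr diffop_lt; apply: funext => f.
by rewrite mulrDr -scalerAr scalerBr addrACA -opprD.
Qed.

Lemma diffop_ltM d s u : diffop_lt d u -> diffop_lt d (fun f => s * u f).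
Proof.
elim: d u => [|d IH] u /= hu; first by move=> f; rewrite hu mulr0.
move=> r; have := IH _ (hu r); congr diffop_lt; apply: funext => f.
by rewrite mulrBr mulrCA.
Qed.

Lemma diffop_lt_comp d e u v : linear u -> linear v ->
  diffop_lt d u -> diffop_lt e v -> diffop_lt (d + e) (fun f => u (v f)).
Proof.
have [k] := ubnP (d + e); elim: k d e u v => // k IH d e u v lek hu hv.
case: d e lek => [|d] [|e] lek hd he.
- by move=> f; rewrite hd.
- rewrite (_ : (fun _ => _) = (fun=> 0)); first exact: diffop_lt0.
  by apply: funext => f; rewrite hd.
- rewrite (_ : (fun _ => _) = (fun=> 0)); first exact: diffop_lt0.
  by apply: funext => f; rewrite he lin0.
rewrite addSn => r.
have h1 : diffop_lt (d + e.+1) (fun f => r * u (v f) - u (r * v f)).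
  apply: (IH d e.+1 (fun f => r * u f - u (r * f)) v) => //.
  exact: linear_comm.
have h2 : diffop_lt (d + e.+1) (fun f => u (r * v f - v (r * f))).
  rewrite addnS -addSn.
  apply: (IH d.+1 e u (fun f => r * v f - v (r * f))) => //.
    by move: lek; rewrite addnS ltnS -addnS addSnnS.
  exact: linear_comm.
have := diffop_ltZD 1 h1 h2; congr diffop_lt; apply: funext => f.
by rewrite scale1r linB // addrA subrK.
Qed.

Lemma is_diffopZD c u v : is_diffop u -> is_diffop v ->
  is_diffop (fun f => c *: u f + v f).
Proof.
move=> [hu [d hd]] [hv [e he]]; split.
  move=> a f g; rewrite hu hv !scalerDr !scalerA [c * a]mulrC.
  by rewrite addrACA.
exists (maxn d e); apply: diffop_ltZD.
- exact: (diffop_ltW hu (leq_maxl _ _)).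
- exact: (diffop_ltW hv (leq_maxr _ _)).
Qed.

Lemma is_diffop0 : is_diffop (fun=> 0).
Proof.
by split; [move=> a f g; rewrite scaler0 addr0 | exists 0%N].
Qed.

Lemma is_diffopZ c u : is_diffop u -> is_diffop (fun f => c *: u f).
Proof.
move=> hu; have := is_diffopZD c hu is_diffop0; congr is_diffop.
by apply: funext => f; rewrite addr0.
Qed.

Lemma is_diffopN u : is_diffop u -> is_diffop (fun f => - u f).
Proof.
move=> /(is_diffopZ (-1)); congr is_diffop.
by apply: funext => f; rewrite scaleN1r.
Qed.

Lemma is_diffopD u v : is_diffop u -> is_diffop v ->
  is_diffop (fun f => u f + v f).
Proof.
move=> hu hv; have := is_diffopZD 1 hu hv; congr is_diffop.
by apply: funext => f; rewrite scale1r.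
Qed.

Lemma is_diffop_mul r : is_diffop (fun f => r * f).
Proof.
split; first by move=> a f g; rewrite mulrDr scalerAr.
by exists 1%N => s f; rewrite mulrCA subrr.
Qed.

Lemma is_diffop_id : is_diffop (fun f => f).
Proof.
have := is_diffop_mul 1; congr is_diffop.
by apply: funext => f; rewrite mul1r.
Qed.

Lemma is_diffop_comp u v : is_diffop u -> is_diffop v ->
  is_diffop (fun f => u (v f)).
Proof.
move=> [hu [d hd]] [hv [e he]]; split; first by move=> a f g; rewrite hv hu.
by exists (d + e)%N; exact: diffop_lt_comp.
Qed.

HB.instance Definition _ := gen_eqMixin diffop.
HB.instance Definition _ := gen_choiceMixin diffop.

Definition diffop0 := Diffop is_diffop0.
Definition diffop1 := Diffop is_diffop_id.
Definition diffop_opp (u : diffop) := Diffop (is_diffopN (diffop_prop u)).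
Definition diffop_add (u v : diffop) :=
  Diffop (is_diffopD (diffop_prop u) (diffop_prop v)).
Definition diffop_comp (u v : diffop) :=
  Diffop (is_diffop_comp (diffop_prop u) (diffop_prop v)).
Definition diffop_scale (c : K) (u : diffop) :=
  Diffop (is_diffopZ c (diffop_prop u)).

Fact diffop_addA : associative diffop_add.
Proof. by move=> u v w; apply: diffopP => f /=; rewrite addrA. Qed.
Fact diffop_addC : commutative diffop_add.
Proof. by move=> u v; apply: diffopP => f /=; rewrite addrC. Qed.
Fact diffop_add0 : left_id diffop0 diffop_add.
Proof. by move=> u; apply: diffopP => f /=; rewrite add0r. Qed.
Fact diffop_addN : left_inverse diffop0 diffop_opp diffop_add.
Proof. by move=> u; apply: diffopP => f /=; rewrite addNr. Qed.

HB.instance Definition _ := GRing.isZmodule.Build diffop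
  diffop_addA diffop_addC diffop_add0 diffop_addN.

Fact diffop_compA : associative diffop_comp.
Proof. by move=> u v w; exact: diffopP. Qed.
Fact diffop_comp1l : left_id diffop1 diffop_comp.
Proof. by move=> u; exact: diffopP. Qed.
Fact diffop_comp1r : right_id diffop1 diffop_comp.
Proof. by move=> u; exact: diffopP. Qed.
Fact diffop_compDl : left_distributive diffop_comp diffop_add.
Proof. by move=> u v w; exact: diffopP. Qed.
Fact diffop_compDr : right_distributive diffop_comp diffop_add.
Proof.
move=> u v w; apply: diffopP => f /=.
by rewrite -[v f]scale1r (diffop_linear u) !scale1r.
Qed.
Fact diffop1_neq0 : diffop1 != 0.
Proof.
apply/eqP => /(congr1 (fun u : diffop => u 1)) /= /eqP.
by rewrite oner_eq0.
Qed.

HB.instance Definition _ := GRing.Zmodule_isNzRing.Build diffop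
  diffop_compA diffop_comp1l diffop_comp1r diffop_compDl diffop_compDr
  diffop1_neq0.

Fact diffop_scaleA a b (u : diffop) :
  diffop_scale a (diffop_scale b u) = diffop_scale (a * b) u.
Proof. by apply: diffopP => f /=; rewrite scalerA. Qed.
Fact diffop_scale1 : left_id 1 diffop_scale.
Proof. by move=> u; apply: diffopP => f /=; rewrite scale1r. Qed.
Fact diffop_scaleDr : right_distributive diffop_scale +%R.
Proof. by move=> a u v; apply: diffopP => f /=; rewrite scalerDr. Qed.
Fact diffop_scaleDl (u : diffop) : {morph diffop_scale^~ u : a b / a + b}.
Proof. by move=> a b; apply: diffopP => f /=; rewrite scalerDl. Qed.

HB.instance Definition _ := GRing.Zmodule_isLmodule.Build K diffop
  diffop_scaleA diffop_scale1 diffop_scaleDr diffop_scaleDl.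

Fact diffop_scaleAl (a : K) (u v : diffop) : a *: (u * v) = (a *: u) * v.
Proof. exact: diffopP. Qed.
HB.instance Definition _ :=
  GRing.Lmodule_isLalgebra.Build K diffop diffop_scaleAl.

Fact diffop_scaleAr (a : K) (u v : diffop) : a *: (u * v) = u * (a *: v).
Proof. by apply: diffopP => f /=; rewrite linZ //; exact: diffop_linear. Qed.
HB.instance Definition _ :=
  GRing.Lalgebra_isAlgebra.Build K diffop diffop_scaleAr.

Definition diffop_mul (r : P) : diffop := Diffop (is_diffop_mul r).

(* The exponent m - j e_i is truncated at 0, but 'C(m i, j) = 0 when
   m i < j. *)
Definition divpartial_fun (i : 'I_n) (j : nat) (f : P) : P :=
  \sum_(m <- msupp f)
    ('C(m i, j)%:R * mcoeff m f) *: mpolyX K (mnm_sub m (mnm_muln (mnm1 i) j)).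

Lemma divpartial_funwE i j f k : (mmeasure mdeg f <= k)%N ->
  divpartial_fun i j f = \sum_(m : bmultinom n k)
    ('C((m : multinom n) i, j)%:R * mcoeff m f) *:
      mpolyX K (mnm_sub m (mnm_muln (mnm1 i) j)).
Proof.
pose I : subFinType _ := bmultinom n k.
move=> le_pk; rewrite /divpartial_fun (big_mksub I) /=; first last.
  by move=> x /msize_mdeg_lt/leq_trans/(_ le_pk).
  by rewrite msupp_uniq.
rewrite big_rmcond //= => m /memN_msupp_eq0 ->.
by rewrite mulr0 scale0r.
Qed.

Lemma divpartial_linear i j : linear (divpartial_fun i j).
Proof.
move=> c f g.
pose k := maxn (mmeasure mdeg f) (maxn (mmeasure mdeg g) (mmeasure mdeg (c *: f + g))).
rewrite !(@divpartial_funwE _ _ _ k) /k ?leq_max ?leqnn ?orbT //.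
rewrite scaler_sumr -big_split /=; apply/eq_bigr=> m _.
rewrite !scalerA -scalerDl; congr (_ *: _).
by rewrite mcoeffD mcoeffZ mulrDr mulrCA.
Qed.

Lemma divpartialX i j m : divpartial_fun i j (mpolyX K m) =
  'C(m i, j)%:R *: mpolyX K (mnm_sub m (mnm_muln (mnm1 i) j)).
Proof. by rewrite /divpartial_fun msuppX big_seq1 mcoeffX eqxx mulr1. Qed.

Lemma divpartial0 i f : divpartial_fun i 0 f = f.
Proof.
rewrite [RHS]mpolyE /divpartial_fun; apply: eq_bigr => m _; rewrite bin0 mul1r.
by congr (_ *: mpolyX _ _); apply/mnmP => l; rewrite mnmBE mulmnE muln0 subn0.
Qed.

Lemma divpartial_sum i j (I : Type) (s : seq I) (F : I -> P) :
  divpartial_fun i j (\sum_(x <- s) F x) = \sum_(x <- s) divpartial_fun i j (F x).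
Proof.
elim: s => [|x s IH]; first by rewrite !big_nil lin0 //; exact: divpartial_linear.
by rewrite !big_cons -[F x]scale1r divpartial_linear IH !scale1r.
Qed.

Lemma divpartial_Leibniz i j r f : divpartial_fun i j (r * f) =
  \sum_(a < j.+1) divpartial_fun i a r * divpartial_fun i (j - a) f.
Proof.
have lin := divpartial_linear.
rewrite [r]mpolyE mulr_suml divpartial_sum.
under [RHS]eq_bigr do rewrite divpartial_sum mulr_suml.
rewrite exchange_big; apply: eq_bigr => m _ /=.
rewrite -scalerAl linZ //.
under [RHS]eq_bigr do rewrite linZ // -scalerAl.
rewrite -scaler_sumr; congr (_ *: _).
rewrite [f]mpolyE mulr_sumr divpartial_sum.
under [RHS]eq_bigr do rewrite divpartial_sum mulr_sumr.
rewrite exchange_big; apply: eq_bigr => k _ /=.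
rewrite -scalerAr linZ //.
under [RHS]eq_bigr do rewrite linZ // -scalerAr.
rewrite -scaler_sumr; congr (_ *: _).
rewrite -mpolyXD divpartialX mnmDE -binomial.Vandermonde natr_sum scaler_suml.
apply: eq_bigr => [[a /= ha]] _; rewrite !divpartialX -scalerAl -scalerAr scalerA.
rewrite natrM; have [lea|/bin_small->] := leqP a (m i); last by rewrite mul0r !scale0r.
have [leb|/bin_small->] := leqP (j - a) (k i); last by rewrite mulr0 !scale0r.
rewrite -mpolyXD; congr (_ *: mpolyX _ _); apply/mnmP => l.
rewrite !(mnmDE, mnmBE, mulmnE, mnm1E); have [<-|_] := eqVneq i l; last by rewrite !mul0n !subn0.
by rewrite !mul1n addnBA // addnBAC // -subnDA subnKC.
Qed.

Lemma is_diffop_divpartial i j : is_diffop (divpartial_fun i j).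
Proof.
split; first exact: divpartial_linear.
exists j.+1; have [k] := ubnP j; elim: k j => // k IH j; rewrite ltnS => lejk.
move=> r; rewrite (_ : (fun _ => _) = fun f => - 1 *:
    (\sum_(a < j) divpartial_fun i a.+1 r * divpartial_fun i (j - a.+1) f) + 0); last first.
  apply: funext => f; rewrite divpartial_Leibniz big_ord_recl /= subn0 addr0 scaleN1r.
  by rewrite divpartial0 opprD addrA subrr add0r.
apply: diffop_ltZD; last exact: diffop_lt0.
elim: (index_enum _) => [|a s IHs].
  rewrite (_ : (fun _ => _) = (fun=> 0)); first exact: diffop_lt0.
  by apply: funext => f; rewrite big_nil.
rewrite (_ : (fun _ => _) = fun f =>
   1 *: (divpartial_fun i a.+1 r * divpartial_fun i (j - a.+1) f) +
  \sum_(a <- s) divpartial_fun i a.+1 r * divpartial_fun i (j - a.+1) f).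
  apply: diffop_ltZD => //; apply: diffop_ltM.
  have lt : (j - a.+1 < j)%N by rewrite ltn_subrL /=; case: a; case: (j).
  apply: (diffop_ltW _ lt); first exact: divpartial_linear.
  by apply: IH; exact: leq_trans lt lejk.
by apply: funext => f; rewrite big_cons scale1r.
Qed.

Definition divpartial (i : 'I_n) (j : nat) : diffop :=
  Diffop (is_diffop_divpartial i j).

Definition divpartialm (b : multinom n) : diffop :=
  \prod_(i < n) divpartial i (b i).

Definition canonical_filtration (i : nat) : set diffop :=
  [set u | exists k (c : 'I_k -> K) (a b : 'I_k -> multinom n),
     (forall j, mdeg (a j) + mdeg (b j) <= i)%N /\
     u = \sum_j c j *: (diffop_mul (mpolyX K (a j)) * divpartialm (b j))].

End DifferentialOperators.

Section Modules.
Context (A : pzRingType) (M : lmodType A).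

Definition finitely_presented : Prop :=
  exists k (g : 'I_k -> M),
    (forall x, exists c : 'I_k -> A, x = \sum_i c i *: g i) /\
    exists l (s : 'I_l -> 'I_k -> A), forall u : 'I_k -> A,
      \sum_i u i *: g i = 0 <->
      exists c : 'I_l -> A, forall i, u i = \sum_j c j * s j i.

Definition act_set (F : set A) (V : set M) : set M :=
  [set x | exists k (a : 'I_k -> A) (v : 'I_k -> M),
     [/\ forall j, F (a j), forall j, V (v j) & x = \sum_j a j *: v j]].

End Modules.

Section Holonomic.
Context (K : fieldType) (n : nat) (M : lmodType (diffop K n)).
Implicit Types V : set M.

(* K acts on M through the scalar operators c%:A = c *: 1 of diffop K n. *)
Definition Kcomb k (b : 'I_k -> M) (c : 'I_k -> K) : M :=
  \sum_i (c i)%:A *: b i.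

Definition has_Kdim V (d : nat) : Prop :=
  exists b : 'I_d -> M,
    (forall c, Kcomb b c = 0 -> forall i, c i = 0) /\ V = range (Kcomb b).

(* Equal to 0 when V is not a finite dimensional K-subspace. *)
Definition Kdim V : nat := xget 0%N (has_Kdim V).

Definition generating_space V : Prop :=
  (exists d, has_Kdim V d) /\ act_set setT V = setT.

Definition hilbert V (i : nat) : nat :=
  Kdim (act_set (@canonical_filtration K n i) V).

Definition holonomic : Prop :=
  (exists x : M, x != 0) /\
  exists V, generating_space V /\
    exists q : {poly rat}, size q = n.+1 /\
      \forall i \near \oo, (hilbert V i)%:R <= q.[i%:R].

Definition is_multiplicity (R : realType) (e : R) : Prop :=
  forall V, generating_space V ->
    (fun i : nat => (hilbert V i)%:R - e / n`!%:R * i%:R ^+ n : R^o) =o_\oo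
    (fun i : nat => i%:R ^+ n : R^o).

Lemma is_multiplicity_unique (R : realType) (e1 e2 : R) :
  holonomic -> is_multiplicity e1 -> is_multiplicity e2 -> e1 = e2.
Proof.
move=> [_ [V [hV _]]] /(_ V hV) h1 /(_ V hV) h2.
apply/eqP; rewrite -subr_eq0; apply/eqP.
have f_gt0 : 0 < (n`!%:R : R) by rewrite ltr0n fact_gt0.
apply/normr0_eq0/eqP; rewrite -[_ == _]negbK -normr_gt0 normr_id; apply/negP => d_gt0.
set d := `|e1 - e2| in d_gt0.
have eps_gt0 : 0 < d / n`!%:R / 3 :> R by rewrite !divr_gt0.
move/eqoP: h1 => /(_ _ eps_gt0) h1; move/eqoP: h2 => /(_ _ eps_gt0) h2.
have [N _ hN] := filterI h1 h2.
have [] := hN N.+1 (leqnSn N).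
set x := (hilbert V N.+1)%:R; set y := N.+1%:R ^+ n => /= hx1 hx2.
have y_gt0 : 0 < y by rewrite exprn_gt0.
have hx1' := hx1; rewrite distrC in hx1'.
have := le_trans (ler_distD x (e1 / n`!%:R * y) (e2 / n`!%:R * y))
  (lerD hx1' hx2).
rewrite -mulrBl -mulrBl normrM (gtr0_norm y_gt0) -mulrDl ler_pM2r //.
rewrite normrM -/d gtr0_norm ?invr_gt0 // leNgt => /negP; apply.
have : 0 < d / n`!%:R by rewrite divr_gt0.
by move: (d / n`!%:R) => t; lra.
Qed.

End Holonomic.

(* Main.v *)
(** Let [q = p^k] and let [C_k] be the ring of operators commuting with all
    [x_i^q]. In characteristic [p] the [C_k] exhaust [D = D(P_n)], [C_k] is the
    matrix algebra of [P_n] over the polynomials in the [x_i^q], with matrix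
    units [x^a T x^(Q-b)], where [Q = (q-1, ..., q-1)] and [T = d^[Q]], and [D]
    is a free right [C_k]-module on the [d^[q b]]. A finite presentation of [M]
    has its relations in some [C_k], so [M] is the direct sum of the
    [d^[q b] M_k], where [M_k] is the [C_k]-module generated by the generators,
    and [M_k] is the direct sum of the [x^a N], [a < q], where [N] is the image
    of the idempotent [T x^Q] in [M_k]. Since [d^[q b] x^a] has degree
    [q |b| + |a|], counting the pairs [(b, a)] shows that the canonical
    filtration grows like [dim N * i^n / n!]. Hence holonomicity forces [N] to be
    finite dimensional, and its dimension is the multiplicity. *)
Require Import Defs.
From HB Require Import structures.
From mathcomp Require Import all_boot all_order all_algebra.
From mathcomp Require Import -(notations) mpoly.
From mathcomp Require Import boolp classical_sets reals normedtype.
From mathcomp Require Import landau.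
From mathcomp Require Import zify.
Import Order.TTheory GRing.Theory Num.Theory numFieldNormedType.Exports.
Local Open Scope ring_scope.

Set Implicit Arguments.
Unset Strict Implicit.
Unset Printing Implicit Defensive.

(** Both sides are the trinomial coefficient [m! / (a! b! (m-a-b)!)], and both vanish when
    [m < a + b]. *)
Lemma bin_mul_bin_sub m a b :
  ('C(m, b) * 'C(m - b, a) = 'C(a + b, a) * 'C(m, a + b))%N.
Proof.
have [le_abm|lt_mab] := leqP (a + b) m; last first.
  rewrite (bin_small lt_mab) muln0; have [lebm|/bin_small->//] := leqP b m.
  by rewrite [X in (_ * X)%N]bin_small ?muln0 //; lia.
have fac_gt0 : (0 < a`! * b`! * (m - (a + b))`!)%N by rewrite !muln_gt0 !fact_gt0.
apply/eqP; rewrite -(eqn_pmul2r fac_gt0); apply/eqP.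
have h1 := bin_fact (leq_trans (leq_addl a b) le_abm).
have h2 : ('C(m - b, a) * (a`! * (m - b - a)`!) = (m - b)`!)%N by apply: bin_fact; lia.
have h3 := bin_fact le_abm.
have h4 := bin_fact (leq_addr b a); rewrite addKn in h4.
have -> : ('C(m, b) * 'C(m - b, a) * (a`! * b`! * (m - (a + b))`!) =
  'C(m, b) * (b`! * ('C(m - b, a) * (a`! * (m - b - a)`!))))%N.
  by rewrite -subnDA [(b + a)%N]addnC; lia.
rewrite h2 h1 -h3 -h4; lia.
Qed.

(** * Binomial coefficients in characteristic [p] *)

Section BinomialCharP.
Context (K : fieldType) (p k : nat) (hp : p \in [pchar K]).
Local Notation q := (p ^ k)%N.

Let pr_p : prime p. Proof. exact: pcharf_prime hp. Qed.

Lemma pchar_exp_gt0 : (0 < q)%N.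
Proof. by rewrite expn_gt0 prime_gt0. Qed.

(** Since [j C(q, j) = q C(q-1, j-1)], if [p] did not divide [C(q, j)] then [q] would divide [j],
    which is too small. *)
Lemma bin_pchar_exp j : (0 < j < q)%N -> 'C(q, j)%:R = 0 :> K.
Proof.
case/andP=> j_gt0 lt_jq; apply/eqP; rewrite -(dvdn_pcharf hp).
apply/negPn/negP => ndvd.
have : (q %| j * 'C(q, j))%N.
  by case: j j_gt0 {lt_jq ndvd} => // j _; rewrite -mul_bin_diag dvdn_mulr.
rewrite Gauss_dvdl ?coprimeXl ?prime_coprime //.
by move/(dvdn_leq j_gt0); rewrite leqNgt lt_jq.
Qed.

(* (1 + X)^(q + m) = (1 + X^q) (1 + X)^m in characteristic p. *)
Lemma binDl_pchar m s :
  'C(q + m, s)%:R = 'C(m, s)%:R + (if (q <= s)%N then 'C(m, s - q)%:R else 0) :> K.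
Proof.
rewrite -binomial.Vandermonde natr_sum (bigD1 ord0) //= bin0 mul1n subn0.
congr (_ + _); have q_gt0 := pchar_exp_gt0; case: leqP => [le_qs|lt_sq].
  have lt_q : (q < s.+1)%N by [].
  rewrite (bigD1 (Ordinal lt_q)) /=; last by rewrite -val_eqE /= -lt0n.
  rewrite binn mul1n big1 ?addr0 // => j /andP[j0 jq]; rewrite natrM.
  rewrite -!val_eqE /= in j0 jq.
  have [lt_jq|lt_qj|] := ltngtP j q; last by move/eqP: jq.
    by rewrite bin_pchar_exp ?mul0r // lt0n j0.
  by rewrite bin_small // mul0r.
rewrite big1 // => j j0; rewrite natrM bin_pchar_exp ?mul0r // lt0n.
by rewrite -val_eqE /= in j0; rewrite j0 (leq_trans (ltn_ord j)).
Qed.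

(** A case of Lucas' theorem, by iterating [binDl_pchar]: its second term is absent as [a < q]. *)
Lemma bin_mod_pchar b a : (a < q)%N -> 'C(a + b * q, a)%:R = 1 :> K.
Proof.
move=> lt_aq; elim: b => [|b IH]; first by rewrite mul0n addn0 binn.
by rewrite mulSn addnCA binDl_pchar leqNgt lt_aq addr0.
Qed.

(** The upper index is [q - 1] for [a = b] and smaller for [b < a]; for [a < b] it is
    [q + (b - a - 1)], and [binDl_pchar] reduces to [C(b - a - 1, q - 1) = 0]. *)
Lemma bin_trace_pchar a b : (a < q)%N -> (b < q)%N ->
  'C(q.-1 - a + b, q.-1)%:R = (a == b)%:R :> K.
Proof.
have q_gt0 := pchar_exp_gt0.
move=> lta ltb; have [lt_ab|lt_ba|->] := ltngtP a b.
- have -> : (q.-1 - a + b = q + (b - a.+1))%N by lia.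
  rewrite binDl_pchar bin_small; last by lia.
  by case: leqP => [|_]; [lia|rewrite addr0].
- by rewrite bin_small //; lia.
- by rewrite subnK ?binn //; lia.
Qed.

End BinomialCharP.

(** * Dimension over [K] *)

Section KDimension.
Context (K : fieldType) (n : nat) (M : lmodType (diffop K n)).

Lemma scalerA_comm (u : diffop K n) (c : K) (x : M) :
  u *: (c%:A *: x) = c%:A *: (u *: x).
Proof. by rewrite !scalerA mulr_algl mulr_algr. Qed.

Lemma scaler_algZ (c : K) (u : diffop K n) (x : M) :
  (c *: u) *: x = c%:A *: (u *: x).
Proof. by rewrite scalerA mulr_algl. Qed.

Lemma scaler_algM (c d : K) (x : M) : c%:A *: (d%:A *: x) = (c * d)%:A *: x.
Proof. by rewrite scalerA mulr_algl scalerA. Qed.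

Lemma scaler_alg_sum (I : finType) (c : I -> K) (x : M) :
  (\sum_i c i)%:A *: x = \sum_i (c i)%:A *: x.
Proof. by rewrite scaler_suml scaler_suml. Qed.

Definition Kspan (I : finType) (w : I -> M) : set M :=
  [set x | exists c : I -> K, x = \sum_i (c i)%:A *: w i]%classic.

Definition Kfree (I : finType) (w : I -> M) : Prop :=
  forall c : I -> K, \sum_i (c i)%:A *: w i = 0 -> forall i, c i = 0.

Lemma Kspan_mem (I : finType) (w : I -> M) i : Kspan w (w i).
Proof.
exists (fun j => (j == i)%:R); rewrite (bigD1 i) //= eqxx scale1r scale1r big1 ?addr0 //.
by move=> j /negbTE->; rewrite !scale0r.
Qed.

Lemma Kspan_trans (I J : finType) (v : I -> M) (w : J -> M) :
  (forall i, Kspan w (v i)) -> (Kspan v `<=` Kspan w)%classic.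
Proof.
move=> /choice[a va] x [c ->]; exists (fun j => \sum_i c i * a i j).
under eq_bigr do rewrite va scaler_sumr.
rewrite exchange_big /=; apply: eq_bigr => j _; rewrite scaler_alg_sum.
by apply: eq_bigr => i _; rewrite scaler_algM.
Qed.

(** Otherwise the matrix of coefficients of [v] in terms of [w] has more rows than columns, and a
    nonzero vector in its left kernel is a linear relation among the [v i]. *)
Lemma Kfree_card_le (I J : finType) (v : I -> M) (w : J -> M) :
  Kfree v -> (forall i, Kspan w (v i)) -> (#|I| <= #|J|)%N.
Proof.
move=> free_v /choice[a va]; rewrite leqNgt; apply/negP => lt_JI.
pose A := \matrix_(i < #|I|, j < #|J|) a (enum_val i) (enum_val j).
have : kermx A != 0.
  rewrite kermx_eq0 /row_free neq_ltn; apply/orP; left.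
  exact: leq_ltn_trans (rank_leq_col A) lt_JI.
case/rowV0Pn => u /sub_kermxP uA; apply/negP; rewrite negbK; apply/eqP/rowP => i.
rewrite mxE -[i]enum_valK; apply: (free_v (fun i => u 0 (enum_rank i))) => {i}.
under eq_bigr do rewrite va scaler_sumr.
rewrite exchange_big big1 //= => j _.
under eq_bigr do rewrite scaler_algM.
rewrite -scaler_alg_sum (_ : \sum_i _ = 0) ?scale0r ?scale0r //.
have /rowP/(_ (enum_rank j)) := uA; rewrite !mxE; apply: etrans.
rewrite [RHS](reindex (@enum_rank I)) /=; last first.
  by exists enum_val => i _; [exact: enum_rankK|exact: enum_valK].
by apply: eq_bigr => i _; rewrite mxE !enum_rankK.
Qed.

Lemma Kspan_ord (I : finType) (w : I -> M) :
  Kspan w = Kspan (fun i : 'I_#|I| => w (enum_val i)).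
Proof.
apply/seteqP; split; apply: Kspan_trans => i; last exact: Kspan_mem.
by rewrite -[i]enum_rankK; exact: Kspan_mem.
Qed.

Lemma has_Kdim_Kspan (I : finType) (w : I -> M) : exists d, has_Kdim (Kspan w) d.
Proof.
rewrite Kspan_ord; move: (fun i : 'I_#|I| => w (enum_val i)) => {}w.
move: #|I| w => {I} d.
elim: d => [|d IH] w.
  exists 0%N, w; split; first by move=> c _ [].
  by apply/seteqP; split=> [x [c ->]|x [c _ <-]]; exists c.
have [free_w|/existsNP[c /not_implyP[c0 /existsNP[i /eqP ci]]]] := pselect (Kfree w).
  exists d.+1, w; split=> //.
  by apply/seteqP; split=> [x [a ->]|x [a _ <-]]; exists a.
suff -> : Kspan w = Kspan (fun j => w (lift i j)) by exact: IH.
apply/seteqP; split; apply: Kspan_trans => j; last exact: Kspan_mem.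
case: (unliftP i j) => [j' ->|->]; first exact: (Kspan_mem (fun j => w (lift i j))).
move: c0; rewrite (bigD1_ord i) //= => /eqP; rewrite addr_eq0 => /eqP c0.
exists (fun j => (c i)^-1 * - c (lift i j)).
under eq_bigr do rewrite -scaler_algM.
rewrite -scaler_sumr; under eq_bigr do rewrite scaleNr scaleNr.
by rewrite sumrN -c0 scaler_algM mulVf // !scale1r.
Qed.

Lemma has_Kdim_unique (V : set M) d e : has_Kdim V d -> has_Kdim V e -> d = e.
Proof.
suff le d1 d2 : has_Kdim V d1 -> has_Kdim V d2 -> (d1 <= d2)%N.
  by move=> hd he; apply/eqP; rewrite eqn_leq !le.
move=> [b [fb Vb]] [b' [fb' Vb']].
have := @Kfree_card_le _ _ b b' fb; rewrite !card_ord; apply => i.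
have : V (b i).
  have [c bc] := Kspan_mem b i; rewrite Vb bc; by exists c.
by rewrite Vb' => -[c _ <-]; exists c.
Qed.

Lemma has_Kdim_Kdim (V : set M) d : has_Kdim V d -> Kdim V = d.
Proof.
by move=> hd; rewrite /Kdim; apply: xget_unique => // e /has_Kdim_unique; exact.
Qed.

Lemma Kdim_Kspan_ge (I J : finType) (v : I -> M) (w : J -> M) :
  Kfree v -> (forall i, Kspan w (v i)) -> (#|I| <= Kdim (Kspan w))%N.
Proof.
move=> fv wv; have [d hd] := has_Kdim_Kspan w; rewrite (has_Kdim_Kdim hd).
have [b [_ wb]] := hd; rewrite -[d]card_ord; apply: (Kfree_card_le fv) => i.
by have := wv i; rewrite wb => -[c _ <-]; exists c.
Qed.

Lemma Kdim_Kspan_le (I J : finType) (v : I -> M) (w : J -> M) :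
  (forall i, Kspan w (v i)) -> (Kdim (Kspan v) <= #|J|)%N.
Proof.
move=> wv; have [d hd] := has_Kdim_Kspan v; rewrite (has_Kdim_Kdim hd).
have [b [fb vb]] := hd; rewrite -[X in (X <= _)%N]card_ord.
apply: (Kfree_card_le fb) => i; apply: (Kspan_trans wv); rewrite vb.
by have [c bc] := Kspan_mem b i; rewrite bc; exists c.
Qed.

End KDimension.

Local Notation "m1 +m m2" := (mnm_add m1 m2) (at level 50, left associativity).
Local Notation "m1 -m m2" := (mnm_sub m1 m2) (at level 50, left associativity).
Local Notation "m *m+ k" := (mnm_muln m k) (at level 40, left associativity).

Lemma mnm_ind n (Q : multinom n -> Prop) :
  Q (@mnm0 n) -> (forall l a, Q a -> Q (mnm1 l +m a)) -> forall a, Q a.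
Proof.
move=> Q0 QS a; have [k] := ubnP (mdeg a); elim: k a => // k IH a lta.
have [->//|] := eqVneq a (@mnm0 n); rewrite -mdeg_eq0 mdegE sum_nat_eq0.
case/forallPn => l /=; rewrite -lep1mP => /submK a1.
rewrite -a1 addmC; apply/QS/IH; move: lta.
by rewrite -[in mdeg a]a1 mdegD mdeg1 addn1 ltnS.
Qed.

(** * Divided powers and the canonical filtration *)

Section Operators.
Context (K : fieldType) (n : nat).
Implicit Types (u v w : diffop K n) (a b c m : multinom n) (f g : mpoly n K).
Local Notation mX := (mpolyX K).
Local Notation mulX m := (diffop_mul (mpolyX K m)).
Local Notation dd := (@divpartialm K n).

Lemma diffopDE u v f : (u + v) f = u f + v f. Proof. by []. Qed.
Lemma diffopME u v f : (u * v) f = u (v f). Proof. by []. Qed.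
Lemma diffop_mulE f g : diffop_mul f g = f * g. Proof. by []. Qed.
Lemma diffopZE (c : K) u f : (c *: u) f = c *: u f. Proof. by []. Qed.
Lemma diffop_sumE (I : Type) (s : seq I) (Q : pred I) (F : I -> diffop K n) f :
  (\sum_(i <- s | Q i) F i) f = \sum_(i <- s | Q i) F i f.
Proof. exact: (big_morph (fun u : diffop K n => u f)). Qed.

Lemma diffop0r u : u 0 = 0. Proof. exact/lin0/diffop_linear. Qed.
Lemma diffopDr u f g : u (f + g) = u f + u g.
Proof. by rewrite -[f]scale1r diffop_linear !scale1r. Qed.
Lemma diffopZr u (c : K) f : u (c *: f) = c *: u f.
Proof. exact/linZ/diffop_linear. Qed.
Lemma diffop_sumr u (I : Type) (s : seq I) (Q : pred I) (F : I -> mpoly n K) :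
  u (\sum_(i <- s | Q i) F i) = \sum_(i <- s | Q i) u (F i).
Proof. exact: (big_morph _ (diffopDr u) (diffop0r u)). Qed.

Lemma diffop_eqX u v : (forall m, u (mX m) = v (mX m)) -> u = v.
Proof.
move=> uv; apply: diffopP => f; rewrite [f]mpolyE !diffop_sumr.
by apply: eq_bigr => m _; rewrite !diffopZr uv.
Qed.

Lemma diffop_mulM f g : diffop_mul (f * g) = diffop_mul f * diffop_mul g.
Proof. by apply: diffopP => h /=; rewrite -mulrA. Qed.

Lemma diffop_mulX0 : mulX (@mnm0 n) = 1 :> diffop K n.
Proof. by apply: diffopP => h /=; rewrite mpolyX0 mul1r. Qed.

Lemma diffop_mulXD a b : mulX (a +m b) = mulX a * mulX b :> diffop K n.
Proof. by rewrite mpolyXD diffop_mulM. Qed.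

Lemma diffop_mulXE f : diffop_mul f = \sum_(m <- msupp f) mcoeff m f *: mulX m.
Proof.
apply: diffopP => g; rewrite diffop_sumE /= {1}[f]mpolyE mulr_suml.
by apply: eq_bigr => m _; rewrite scalerAl.
Qed.

Definition mbin m b : nat := \prod_i 'C(m i, b i).

Lemma mbin0 m : mbin m (@mnm0 n) = 1%N.
Proof. by rewrite /mbin big1 // => i _; rewrite mnm0E bin0. Qed.

Lemma mbin_eq0 m b i : (m i < b i)%N -> mbin m b = 0%N.
Proof. by move=> lt_mb; rewrite /mbin (bigD1 i) //= bin_small. Qed.

Lemma divpartialmX b m : dd b (mX m) = (mbin m b)%:R *: mX (m -m b).
Proof.
rewrite /divpartialm /mbin.
have main (s : seq 'I_n) : uniq s ->
  (\prod_(i <- s) divpartial K i (b i)) (mX m) =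
  (\prod_(i <- s) 'C(m i, b i))%:R *:
    mX (m -m Multinom (mktuple (fun i => if i \in s then b i else 0%N))).
  elim: s => [|i s IH] /=.
    rewrite !big_nil => _; rewrite scale1r; congr mpolyX.
    by apply/mnmP => i; rewrite mnmBE mnmE subn0.
  move=> /andP[nsi us]; rewrite !big_cons diffopME IH // diffopZr /= divpartialX scalerA.
  rewrite mnmBE mnmE (negbTE nsi) subn0 -natrM mulnC; congr (_ *: mpolyX _ _).
  apply/mnmP => j; rewrite !(mnmBE, mnmE, mulmnE) inE [i == j]eq_sym.
  case: eqVneq => [->|ne_ji] /=; first by rewrite (negbTE nsi) subn0 mul1n.
  by rewrite mul0n subn0.
rewrite main ?index_enum_uniq //; congr (_ *: mpolyX _ _).
by apply/mnmP => i; rewrite !mnmBE mnmE mem_index_enum.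
Qed.

Lemma divpartialm0 : dd (@mnm0 n) = 1.
Proof.
by apply: diffop_eqX => m; rewrite divpartialmX mbin0 scale1r subm0.
Qed.

Lemma divpartialmM a b : dd a * dd b = (mbin (a +m b) a)%:R *: dd (a +m b).
Proof.
apply: diffop_eqX => m; rewrite diffopME diffopZE !divpartialmX diffopZr.
rewrite divpartialmX !scalerA submDA [b +m a]addmC -!natrM.
congr (_%:R *: _); rewrite /mbin -!big_split /=; apply: eq_bigr => i _.
by rewrite mnmBE !mnmDE bin_mul_bin_sub.
Qed.

(** The hypothesis is Pascal's rule for [q = 1] and, in characteristic [p], it is [binDl_pchar] for
    [q = p^k]; one computation on monomials serves both. *)
Lemma divpartialm_mulXn q b l :
  (forall j s : nat, 'C(q + j, s)%:R =
    'C(j, s)%:R + (if (q <= s)%N then 'C(j, s - q)%:R else 0) :> K) ->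
  dd b * mulX (mnm1 l *m+ q) =
  mulX (mnm1 l *m+ q) * dd b + (if (q <= b l)%N then dd (b -m mnm1 l *m+ q) else 0).
Proof.
move=> hq; set e := mnm1 l *m+ q.
have el : e l = q by rewrite mulmnE mnm1E eqxx mul1n.
have ene i : i != l -> e i = 0%N.
  by move=> ne_il; rewrite mulmnE mnm1E eq_sym (negbTE ne_il).
have mbinl m' b' : mbin m' b' = ('C(m' l, b' l) * \prod_(i | i != l) 'C(m' i, b' i))%N.
  by rewrite /mbin (bigD1 l).
apply: diffop_eqX => m; rewrite diffopDE !diffopME /= -mpolyXD !divpartialmX.
rewrite -scalerAr -mpolyXD [mbin _ _]mbinl mnmDE el natrM hq mulrDl scalerDl.
have -> : \prod_(i | i != l) 'C((e +m m) i, b i) = \prod_(i | i != l) 'C(m i, b i).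
  by apply: eq_bigr => i ne_il; rewrite mnmDE ene.
rewrite -natrM -mbinl; congr (_ + _).
  (* Subtraction of exponents is truncated, but if some [m i < b i] then the binomial coefficient is
     already zero. *)
  have [/forallP/= bm|/forallPn/=[i]] := boolP [forall i, (b i <= m i)%N].
    by congr (_ *: mpolyX _ _); apply/mnmP => i; rewrite !(mnmBE, mnmDE) addnBA.
  by rewrite -ltnNge => /mbin_eq0->; rewrite !scale0r.
case: ifP => [le_qb|_]; last by rewrite mul0r scale0r.
rewrite divpartialmX mbinl mnmBE el -natrM.
rewrite (eq_bigr (fun i => 'C(m i, (b -m e) i))) => [|i ne_il]; last first.
  by rewrite mnmBE ene // subn0.
congr (_ *: mpolyX _ _); apply/mnmP => i; rewrite !(mnmBE, mnmDE).
have [->|/ene->] := eqVneq i l; last by rewrite subn0.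
by rewrite el subnBA // addnC.
Qed.

Lemma divpartialm_mulX1 b l : dd b * mulX (mnm1 l) =
  mulX (mnm1 l) * dd b + (if (0 < b l)%N then dd (b -m mnm1 l) else 0).
Proof.
rewrite -[mnm1 l]mulm1n; apply: divpartialm_mulXn => j [|s]; first by rewrite !bin0 addr0.
by rewrite add1n binS natrD subn1.
Qed.

Lemma divpartialmC a b : dd a * dd b = dd b * dd a.
Proof.
rewrite !divpartialmM [b +m a]addmC; congr (_%:R *: _); apply: eq_bigr => i _.
by rewrite mnmDE -[in RHS]bin_sub ?leq_addl // addnK.
Qed.

End Operators.

(** * Stability of the canonical filtration under products *)

Section Filtration.
Context (K : fieldType) (n : nat).
Implicit Types (u v w : diffop K n) (a b c m : multinom n) (f g : mpoly n K).
Local Notation mulX m := (diffop_mul (mpolyX K m)).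
Local Notation dd := (@divpartialm K n).
Local Notation CF := (@canonical_filtration K n).

Lemma cfilt_mono i a b : (mdeg a + mdeg b <= i)%N -> CF i (mulX a * dd b).
Proof.
move=> le_i; exists 1%N, (fun=> 1), (fun=> a), (fun=> b); split=> //.
by rewrite big_ord1 scale1r.
Qed.

Lemma cfilt0 i : CF i 0.
Proof.
exists 0%N, (fun=> 0), (fun=> @mnm0 n), (fun=> @mnm0 n).
by split=> [[]//|]; rewrite big_ord0.
Qed.

Lemma cfiltZD i (x : K) u v : CF i u -> CF i v -> CF i (x *: u + v).
Proof.
move=> [k [c [a [b [ab ->]]]]] [k' [c' [a' [b' [ab' ->]]]]].
pose glue T (F : 'I_k -> T) (F' : 'I_k' -> T) (j : 'I_(k + k')) :=
  match split j with inl j => F j | inr j => F' j end.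
have glueL T (F : 'I_k -> T) (F' : 'I_k' -> T) j : glue T F F' (lshift k' j) = F j.
  by rewrite /glue (unsplitK (inl _ j)).
have glueR T (F : 'I_k -> T) (F' : 'I_k' -> T) j : glue T F F' (rshift k j) = F' j.
  by rewrite /glue (unsplitK (inr _ j)).
exists (k + k')%N, (glue _ (fun j => x * c j) c'), (glue _ a a'), (glue _ b b').
split=> [j|]; first by rewrite /glue; case: (split j).
rewrite big_split_ord scaler_sumr /=; congr (_ + _); apply: eq_bigr => j _.
  by rewrite !glueL scalerA.
by rewrite !glueR.
Qed.

Lemma cfiltD i u v : CF i u -> CF i v -> CF i (u + v).
Proof. by move=> hu hv; rewrite -[u]scale1r; exact: cfiltZD. Qed.

Lemma cfiltZ i (x : K) u : CF i u -> CF i (x *: u).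
Proof. by move=> hu; rewrite -[x *: u]addr0; apply: cfiltZD => //; exact: cfilt0. Qed.

Lemma cfilt_ind i (Q : diffop K n -> Prop) :
  Q 0 -> (forall (x : K) u v, Q u -> Q v -> Q (x *: u + v)) ->
  (forall a b, (mdeg a + mdeg b <= i)%N -> Q (mulX a * dd b)) ->
  forall u, CF i u -> Q u.
Proof.
move=> Q0 QD QX u [k [c [a [b [ab ->]]]]].
elim: (index_enum _) => [|j s IH]; first by rewrite big_nil.
by rewrite big_cons; apply: QD => //; exact: QX.
Qed.

Lemma cfilt_sum i (I : Type) (s : seq I) (F : I -> diffop K n) :
  (forall x, CF i (F x)) -> CF i (\sum_(x <- s) F x).
Proof.
by move=> hF; apply: big_ind => //; [exact: cfilt0|exact: cfiltD].
Qed.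

Lemma cfilt_le i j u : (i <= j)%N -> CF i u -> CF j u.
Proof.
move=> le_ij; move: u; apply: cfilt_ind; [exact: cfilt0|exact: cfiltZD|].
by move=> a b /leq_trans/(_ le_ij); exact: cfilt_mono.
Qed.

Lemma cfilt_mulX a i u : CF i u -> CF (mdeg a + i) (mulX a * u).
Proof.
move: u; apply: cfilt_ind; first by rewrite mulr0; exact: cfilt0.
  by move=> x u v hu hv; rewrite mulrDr -scalerAr; exact: cfiltZD.
move=> b c le_i; rewrite mulrA -diffop_mulXD; apply: cfilt_mono.
by rewrite mdegD -addnA leq_add2l.
Qed.

(** Induction on the monomial in [x] to the right of [d^[b]]: by Pascal's rule, moving one variable
    to the left leaves a commutator that is [d^[b - e_l]] or zero. *)
Lemma cfilt_divpartialm b i u : CF i u -> CF (mdeg b + i) (dd b * u).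
Proof.
move: u; apply: cfilt_ind; first by rewrite mulr0; exact: cfilt0.
  by move=> x u v hu hv; rewrite mulrDr -scalerAr; exact: cfiltZD.
move=> a; elim/mnm_ind: a i b => [|l a IH] i b c le_i.
  rewrite diffop_mulX0 mul1r divpartialmM.
  apply: cfiltZ; rewrite -[dd _]mul1r -diffop_mulX0; apply: cfilt_mono.
  by move: le_i; rewrite mdeg0 mdegD; lia.
move: le_i; rewrite mdegD mdeg1; case: i => // i le_i.
rewrite diffop_mulXD -[_ * _ * dd c]mulrA mulrA divpartialm_mulX1 mulrDl; apply: cfiltD.
  rewrite -mulrA addnS -add1n -(mdeg1 l); apply/cfilt_mulX/IH; lia.
case: ifP => [bl|_]; last by rewrite mul0r; exact: cfilt0.
apply: (@cfilt_le (mdeg (b -m mnm1 l) + i)); last by apply: IH; lia.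
by rewrite leq_add ?mdegB.
Qed.

Lemma cfiltM i j u v : CF i u -> CF j v -> CF (i + j) (u * v).
Proof.
move=> hu hv; move: u hu; apply: cfilt_ind.
- by rewrite mul0r; exact: cfilt0.
- by move=> x u w hu hw; rewrite mulrDl -scalerAl; exact: cfiltZD.
move=> a b le_i; rewrite -mulrA; apply: (@cfilt_le (mdeg a + (mdeg b + j))).
  by rewrite addnA leq_add2r.
exact/cfilt_mulX/cfilt_divpartialm.
Qed.

Lemma cfilt_X a : CF (mdeg a) (mulX a).
Proof.
by rewrite -[mulX a]mulr1 -divpartialm0; apply: cfilt_mono; rewrite mdeg0 addn0.
Qed.

Lemma cfilt_dd b : CF (mdeg b) (dd b).
Proof. by rewrite -[dd b]mul1r -diffop_mulX0; apply: cfilt_mono; rewrite mdeg0. Qed.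

Lemma cfilt_mul f : exists i, CF i (diffop_mul f).
Proof.
have [i le_i] : exists i, forall m, m \in msupp f -> (mdeg m <= i)%N.
  by exists (\max_(m <- msupp f) mdeg m)%N => m fm; rewrite (big_rem m fm) leq_maxl.
exists i; rewrite diffop_mulXE big_seq.
apply: (big_ind (CF i)) => [||m fm]; [exact: cfilt0|exact: cfiltD|].
exact/cfiltZ/(cfilt_le (le_i m fm))/cfilt_X.
Qed.

End Filtration.

(** * Operators commuting with the [p^k]-th powers *)

Section Frobenius.
Context (K : fieldType) (n p : nat) (hp : p \in [pchar K]).
Implicit Types (u v w : diffop K n) (a b c m : multinom n) (f g : mpoly n K).
Local Notation mX := (mpolyX K).
Local Notation mulX m := (diffop_mul (mpolyX K m)).
Local Notation dd := (@divpartialm K n).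
Local Notation CF := (@canonical_filtration K n).

Let p_gt0 : (0 < p)%N. Proof. exact/prime_gt0/(pcharf_prime hp). Qed.

(** In the induction, put [s = r^(p^d)]: the commutator [w = [s, u]] commutes with [s], so [[s^i, u]
    = i s^(i-1) w], which vanishes for [i = p]. *)
Lemma diffop_lt_comm_pexp d u r : diffop_lt d u ->
  GRing.comm u (diffop_mul (r ^+ (p ^ d))).
Proof.
elim: d u r => [|d IH] u r ud.
  by apply: diffopP => f; rewrite !diffopME /= !ud mulr0.
rewrite expnSr exprM; set s := r ^+ (p ^ d).
have mulE i : diffop_mul (s ^+ i) = diffop_mul s ^+ i :> diffop K n.
  elim: i => [|i IHi]; first by apply: diffopP => f; exact: mul1r.
  by rewrite !exprS diffop_mulM IHi.
rewrite mulE; set S := diffop_mul s.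
have cw : GRing.comm (S * u - u * S) S by apply: IH; exact: ud.
have uS i : S ^+ i.+1 * u - u * S ^+ i.+1 = S ^+ i * (S * u - u * S) *+ i.+1.
  elim: i => [|i IHi]; first by rewrite expr0 mul1r expr1.
  have -> : S ^+ i.+2 * u - u * S ^+ i.+2 =
      S ^+ i.+1 * (S * u - u * S) + (S ^+ i.+1 * u - u * S ^+ i.+1) * S.
    by rewrite exprSr mulrBr mulrBl !mulrA addrA subrK.
  by rewrite IHi mulrnAl -[_ * _ * S]mulrA cw mulrA -exprSr -mulrS.
apply/esym/subr0_eq; have := uS p.-1; rewrite prednK // => ->.
by rewrite -scaler_nat (pcharf0 hp) scale0r.
Qed.

(** This is the ring [C_k], that is, the operators linear over [K[x_1^q, ..., x_n^q]] with
    [q = p^k]. *)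
Definition level k : set (diffop K n) :=
  [set u | forall l, GRing.comm u (mulX (mnm1 l *m+ (p ^ k)))]%classic.

Lemma level_exists u : exists k, level k u.
Proof.
have [_ [d ud]] := diffop_prop u; exists d => l; rewrite -mpolyXn.
exact: diffop_lt_comm_pexp.
Qed.

Lemma level_le k k' u : (k <= k')%N -> level k u -> level k' u.
Proof.
move=> /subnKC<- hu l; rewrite expnD -mpolyXn exprM mpolyXn.
elim: (p ^ (k' - k))%N => [|i IH].
  by rewrite expr0 -mpolyX0 diffop_mulX0; exact: commr1.
by rewrite exprS diffop_mulM; apply: commrM => //; rewrite mpolyXn; exact: hu.
Qed.

(** * The matrix structure of the operators of level [k] *)

Section Level.
Variable k : nat.
Local Notation q := (p ^ k)%N.
Local Notation level := (level k).

Let q_gt0 : (0 < q)%N. Proof. by rewrite expn_gt0 p_gt0. Qed.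

Lemma level0 : level 0. Proof. by move=> l; exact/commr_sym/commr0. Qed.
Lemma level1 : level 1. Proof. by move=> l; exact/commr_sym/commr1. Qed.
Lemma levelN u : level u -> level (- u).
Proof. by move=> hu l; exact/commr_sym/commrN/commr_sym/hu. Qed.
Lemma levelD u v : level u -> level v -> level (u + v).
Proof. by move=> hu hv l; apply/commr_sym/commrD; exact/commr_sym. Qed.
Lemma levelB u v : level u -> level v -> level (u - v).
Proof. by move=> hu hv; exact/levelD/levelN. Qed.
Lemma levelM u v : level u -> level v -> level (u * v).
Proof. by move=> hu hv l; apply/commr_sym/commrM; exact/commr_sym. Qed.
Lemma levelZ (x : K) u : level u -> level (x *: u).
Proof. by move=> hu l; rewrite /GRing.comm -scalerAl hu scalerAr. Qed.
Lemma level_sum (I : Type) (s : seq I) (F : I -> diffop K n) :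
  (forall i, level (F i)) -> level (\sum_(i <- s) F i).
Proof. by move=> hF; apply: big_ind => //; [exact: level0|exact: levelD]. Qed.

Lemma level_mul f : level (diffop_mul f).
Proof. by move=> l; rewrite /GRing.comm -!diffop_mulM mulrC. Qed.

Lemma level_divpartialm a : (forall l, (a l < q)%N) -> level (dd a).
Proof.
move=> lt_aq l; rewrite /GRing.comm (divpartialm_mulXn _ _ (binDl_pchar k hp)).
by rewrite leqNgt lt_aq addr0.
Qed.

Lemma level_comm u c : level u -> GRing.comm u (mulX (c *m+ q)).
Proof.
move=> hu; elim/mnm_ind: c => [|l c IH].
  rewrite (_ : _ *m+ _ = @mnm0 n) ?diffop_mulX0; first exact: commr1.
  by apply/mnmP => i; rewrite mulmnE mnm0E.
rewrite (_ : _ *m+ _ = mnm1 l *m+ q +m c *m+ q) ?diffop_mulXD; first exact: commrM.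
by apply/mnmP => i; rewrite mnmDE !mulmnE mnmDE mulnDl.
Qed.

Definition mrem m : multinom n := Multinom (mktuple (fun i => m i %% q)%N).
Definition mquo m : multinom n := Multinom (mktuple (fun i => m i %/ q)%N).

Lemma mrem_lt m i : (mrem m i < q)%N. Proof. by rewrite mnmE ltn_mod. Qed.

Lemma mquo_mrem m : m = mrem m +m mquo m *m+ q.
Proof. by apply/mnmP => i; rewrite mnmDE mulmnE !mnmE addnC -divn_eq. Qed.

(** Such operators are linear over the monomials [x^(q c)], and every monomial is one of these times
    some [x^a] with all [a l < q]. *)
Lemma level_eq u v : level u -> level v ->
  (forall a, (forall l, a l < q)%N -> u (mX a) = v (mX a)) -> u = v.
Proof.
move=> hu hv uv; apply: diffop_eqX => m; rewrite (mquo_mrem m) addmC mpolyXD.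
have E w : level w ->
    w (mX (mquo m *m+ q) * mX (mrem m)) = mX (mquo m *m+ q) * w (mX (mrem m)).
  move=> hw; have := level_comm (mquo m) hw.
  by move/(congr1 (fun x : diffop K n => x (mX (mrem m)))).
by rewrite !E // uv //; exact: mrem_lt.
Qed.

Definition mtop : multinom n := Multinom (mktuple (fun=> q.-1)).

(* The coefficient of [x^a] in the basis [x^b], [b < q], of [P_n] over the
   ring of polynomials in the [x_i^q]. *)
Definition mproj a : diffop K n := dd mtop * mulX (mtop -m a).

Lemma level_mproj a : level (mproj a).
Proof.
apply: levelM; last exact: level_mul.
by apply: level_divpartialm => l; rewrite mnmE prednK.
Qed.

(** By [bin_trace_pchar] in each variable, one factor with [a i != b i] already kills the
    coefficient; for [a = b] the remaining exponent is zero. *)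
Lemma mprojX a b : (forall l, a l < q)%N -> (forall l, b l < q)%N ->
  mproj a (mX b) = (a == b)%:R.
Proof.
move=> lta ltb; rewrite diffopME /= -mpolyXD divpartialmX.
have -> : (mbin (mtop -m a +m b) mtop)%:R = (a == b)%:R :> K.
  rewrite /mbin natr_prod; have [<-|ne_ab] := eqVneq a b.
    rewrite big1 // => i _; rewrite mnmDE mnmBE mnmE (bin_trace_pchar hp) ?eqxx //.
  have [i ne_abi] : exists i, a i != b i.
    apply/existsP; apply: contraR ne_ab; rewrite negb_exists => /forallP ab.
    by apply/eqP/mnmP => i; apply/eqP; rewrite -[_ == _]negbK.
  by rewrite (bigD1 i) //= mnmDE mnmBE mnmE (bin_trace_pchar hp) // (negbTE ne_abi) mul0r.
have [<-|_] := eqVneq a b; last by rewrite scale0r.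
rewrite scale1r -mpolyX0; congr mpolyX; apply/mnmP => i.
by rewrite !(mnmBE, mnmDE, mnm0E, mnmE) subnK ?subnn // -ltnS prednK.
Qed.

Definition mexp (e : {ffun 'I_n -> 'I_q}) : multinom n :=
  Multinom (mktuple (fun i => e i : nat)).

Lemma mexp_lt (e : {ffun 'I_n -> 'I_q}) l : (mexp e l < q)%N.
Proof. by rewrite mnmE. Qed.

Lemma mexp_inj : injective mexp.
Proof.
move=> a a' /mnmP aa'; apply/ffunP => i; apply: val_inj.
by have := aa' i; rewrite !mnmE.
Qed.

Lemma mexp_surj a : (forall l, a l < q)%N -> exists e, a = mexp e.
Proof.
move=> lta; exists [ffun i => Ordinal (lta i)].
by apply/mnmP => i; rewrite mnmE ffunE.
Qed.

(** The [mproj (mexp e)] are dual to the [x^e], so both sides agree on these monomials, which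
    suffices by [level_eq]. *)
Lemma level_expand u : level u ->
  u = \sum_e diffop_mul (u (mX (mexp e))) * mproj (mexp e).
Proof.
move=> hu; apply: level_eq => //.
  by apply: level_sum => a; apply: levelM; [exact: level_mul|exact: level_mproj].
move=> b /mexp_surj[{}b ->]; rewrite diffop_sumE (bigD1 b) // diffopME.
rewrite mprojX ?eqxx ?diffop_mulE ?mulr1; try exact: mexp_lt.
rewrite big1 => [|a ne_ab]; first by rewrite [RHS]addr0.
rewrite diffopME mprojX; try exact: mexp_lt.
by rewrite (inj_eq mexp_inj) (negbTE ne_ab) diffop0r.
Qed.

(** A rule for matrix units: [mproj a] is [E_(0,a)] and [x^b * mproj 0] is [E_(b,0)]. *)
Lemma mproj_mulX_mproj0 a b : (forall l, a l < q)%N -> (forall l, b l < q)%N ->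
  mproj a * (mulX b * mproj (@mnm0 n)) = (a == b)%:R *: mproj (@mnm0 n).
Proof.
move=> lta ltb; have lt0 l : (@mnm0 n l < q)%N by rewrite mnm0E.
apply: level_eq => [||c ltc].
- by apply: levelM (levelM _ _); [exact: level_mproj|exact: level_mul|exact: level_mproj].
- by apply: levelZ; exact: level_mproj.
rewrite diffopZE (diffopME (mproj a)) (diffopME (mulX b)) diffop_mulE mprojX //.
case: eqP => _; first by rewrite mulr1 mprojX // scaler_nat; case: eqP.
by rewrite mulr0 diffop0r scaler0.
Qed.

Lemma mproj0_mproj a : (forall l, a l < q)%N ->
  mproj (@mnm0 n) * mproj a = mproj a.
Proof.
move=> lta; have lt0 l : (@mnm0 n l < q)%N by rewrite mnm0E.
apply: level_eq => [||c ltc]; [by apply: levelM; exact: level_mproj|exact: level_mproj|].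
rewrite diffopME mprojX //; case: eqP => _; last exact: diffop0r.
by rewrite -mpolyX0 mprojX // eqxx mpolyX0.
Qed.

Lemma divpartialm_quo_rem a : dd (mquo a *m+ q) * dd (mrem a) = dd a.
Proof.
rewrite divpartialmC divpartialmM -mquo_mrem [X in X *: _](_ : _ = 1) ?scale1r //.
rewrite natr_prod big1 // => i _.
rewrite {1}(mquo_mrem a) mnmDE mulmnE; apply: (bin_mod_pchar hp); exact: mrem_lt.
Qed.

(** Freeness of [D] as a right module over [C_k]. Taking the commutator with [x_l^q] turns [d^[q b]]
    into [d^[q (b - e_l)]] and keeps the coefficients, so it gives a shorter relation. *)
Lemma level_free d (u : multinom n -> diffop K n) :
  (forall b, level (u b)) ->
  \sum_(b : bmultinom n d) dd (mnm_muln b q) * u b = 0 ->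
  forall b, (mdeg b < d)%N -> u b = 0.
Proof.
elim: d u => [|d IH] u hu u0 //.
have step l c : (mdeg c < d)%N -> u (mnm1 l +m c) = 0.
  move: c; apply: IH => [c|]; first exact: hu.
  pose F (b : multinom n) := dd ((b -m mnm1 l) *m+ q) * u b.
  transitivity (\sum_(b : bmultinom n d.+1 | (0 < (b : multinom n) l)%N) F b).
    pose h (c : bmultinom n d) : bmultinom n d.+1 :=
      @BMultinom n d.+1 (mnm1 l +m c) ltac:(by rewrite mdegD mdeg1 ltnS bmdeg).
    rewrite (reindex_omap h (fun b : bmultinom n d.+1 => insub (b -m mnm1 l))) /=.
      apply: eq_big => [c|c _]; last by rewrite /F /= addmC addmK.
      by rewrite mnmDE mnm1E eqxx /= addmC addmK valK eqxx.
    move=> b bl; have bK : mnm1 l +m (b -m mnm1 l) = b.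
      by rewrite addmC submK // lep1mP -lt0n.
    have lt_bd : (mdeg (b -m mnm1 l) < d)%N.
      by have := bmdeg b; rewrite -{1}bK mdegD mdeg1 add1n ltnS.
    by rewrite insubT /=; congr Some; apply: val_inj.
  have [X XE] : exists X, X = mulX (mnm1 l *m+ q) by eexists.
  (* The commutator of a vanishing sum with [x_l^q] vanishes; as [x_l^q] commutes with every [u b],
     only its commutators with the [d^[q b]] remain. *)
  transitivity ((\sum_(b : bmultinom n d.+1) dd (mnm_muln b q) * u b) * X -
    X * (\sum_(b : bmultinom n d.+1) dd (mnm_muln b q) * u b)); last first.
    by rewrite u0 mul0r mulr0 subrr.
  rewrite mulr_suml mulr_sumr -sumrB big_mkcond; apply: eq_bigr => b _ /=.
  rewrite -mulrA XE hu mulrA (divpartialm_mulXn _ _ (binDl_pchar k hp)).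
  rewrite mulrDl -mulrA addrC addKr mulmnE -{1}[q]mul1n leq_pmul2r //.
  case: ifP => _; last by rewrite mul0r.
  congr (dd _ * _); apply/mnmP => i; rewrite !(mnmBE, mulmnE) mulnBl //.
have un0 b : b != @mnm0 n -> (mdeg b < d.+1)%N -> u b = 0.
  elim/mnm_ind: b => [|l c _ _]; first by rewrite eqxx.
  by rewrite mdegD mdeg1 add1n ltnS => /step.
move=> b ltb; have [b0|/un0->//] := eqVneq b (@mnm0 n).
(* Only the term [b = 0] is left, and its divided power is [1]. *)
move: u0; rewrite (bigD1 (@bm0 n d)) //= big1 => [|c c0]; last first.
  by rewrite un0 ?mulr0 ?bmdeg.
rewrite addr0 b0 /= (_ : @mnm0 n *m+ q = @mnm0 n) ?divpartialm0 ?mul1r //.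
by apply/mnmP => i; rewrite mulmnE mnm0E.
Qed.

End Level.

(** At a suitable level [u] is a finite sum of polynomials times the [mproj (mexp a)], each of
    finite degree; thus the canonical filtration exhausts [D]. *)
Lemma cfilt_exists u : exists i, CF i u.
Proof.
have [k /level_expand->] := level_exists u.
have main (a : {ffun 'I_n -> 'I_(p ^ k)}) :
    exists i, CF i (diffop_mul (u (mX (mexp a))) * mproj k (mexp a)).
  have [i hi] := cfilt_mul (u (mX (mexp a))).
  exists (i + (mdeg (mtop k) + mdeg (mtop k -m mexp a)))%N.
  by apply/cfiltM/cfiltM => //; [exact: cfilt_dd|exact: cfilt_X].
have /choice[i hi] := main; exists (\max_a i a)%N.
by apply: cfilt_sum => a; apply/cfilt_le/hi/leq_bigmax.
Qed.

End Frobenius.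

Lemma big_bmultinom_widen (V : nmodType) n d e (F : multinom n -> V) : (d <= e)%N ->
  \sum_(b : bmultinom n d) F b =
  \sum_(b : bmultinom n e | (mdeg (b : multinom n) < d)%N) F b.
Proof.
move=> le_de; pose h (c : bmultinom n d) : bmultinom n e :=
  BMultinom (leq_trans (bmdeg c) le_de).
rewrite [RHS](reindex_omap h (fun b : bmultinom n e => insub (b : multinom n))) /=.
  by apply: eq_bigl => b; rewrite bmdeg valK eqxx.
by move=> b ltb; rewrite insubT /=; congr Some; apply: val_inj.
Qed.

(** * Frobenius descent *)

Section LevelModule.
Context (K : fieldType) (n p : nat) (hp : p \in [pchar K]) (k : nat).
Local Notation q := (p ^ k)%N.
Local Notation mulX m := (diffop_mul (mpolyX K m)).
Local Notation dd := (@divpartialm K n).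
Local Notation CF := (@canonical_filtration K n).
Local Notation level := (@level K n p k).

Let q_gt0 : (0 < q)%N. Proof. exact: pchar_exp_gt0 hp. Qed.

(** * Modules generated from level [k] *)

Section Induced.
Context (M : lmodType (diffop K n)).
Implicit Types (N : set M) (x y : M).

Definition level_submod N : Prop :=
  [/\ N 0, forall x y, N x -> N y -> N (x + y) &
      forall u x, level u -> N x -> N (u *: x)].

(** A filtration of [D N] by the size of [b] in [d^[q b]]. The degree bound in [bmultinom] is
    strict, hence [t.+1]. *)
Definition induced N t : set M :=
  [set x | exists m : multinom n -> M, (forall b, N (m b)) /\
    x = \sum_(b : bmultinom n t.+1) dd (mnm_muln b q) *: m b]%classic.

Context (N : set M) (hN : level_submod N).
Local Notation SS := (induced N).

Lemma induced0 t : SS t 0.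
Proof.
case: hN => N0 _ _; exists (fun=> 0); split=> //.
by rewrite big1 // => b _; rewrite scaler0.
Qed.

Lemma inducedD t x y : SS t x -> SS t y -> SS t (x + y).
Proof.
case: hN => _ ND _ [m [Nm ->]] [m' [Nm' ->]]; exists (fun b => m b + m' b); split.
  by move=> b; exact: ND.
by rewrite -big_split; apply: eq_bigr => b _; rewrite /= scalerDr.
Qed.

Lemma inducedZ t (c : K) x : SS t x -> SS t (c%:A *: x).
Proof.
case: hN => _ _ NZ [m [Nm ->]]; exists (fun b => c%:A *: m b); split.
  by move=> b; apply: NZ => //; exact/levelZ/level1.
by rewrite scaler_sumr; apply: eq_bigr => b _; rewrite scalerA_comm.
Qed.

Lemma induced_sum t (I : Type) (s : seq I) (Q : pred I) (F : I -> M) :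
  (forall i, Q i -> SS t (F i)) -> SS t (\sum_(i <- s | Q i) F i).
Proof. by move=> hF; apply: big_ind => //; [exact: induced0|exact: inducedD]. Qed.

Lemma induced_base t b x : (mdeg b <= t)%N -> N x -> SS t (dd (b *m+ q) *: x).
Proof.
move=> le_bt Nx; case: hN => N0 _ _; exists (fun c => if c == b then x else 0); split.
  by move=> c; case: ifP.
rewrite (bigD1 (@BMultinom n t.+1 b le_bt)) //= eqxx big1 ?addr0 // => c.
by rewrite -val_eqE /= => /negbTE->; rewrite scaler0.
Qed.

(** With [c = r + q s] and all [r l < q], the factor [d^[r]] has level [k] and is absorbed by [N],
    while [q |s| <= |c|] bounds [|s|] by [t]. *)
Lemma induced_divpartialm t c x : (mdeg c < t.+1 * q)%N -> N x -> SS t (dd c *: x).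
Proof.
move=> ltc Nx; case: (hN) => _ _ NZ; rewrite -(divpartialm_quo_rem hp k) -scalerA.
apply: induced_base; last first.
  by apply: NZ => //; apply: (level_divpartialm hp) => l; exact: (mrem_lt hp).
move: ltc; rewrite {1}(mquo_mrem p k c) mdegD mdegMn => /(leq_ltn_trans (leq_addl _ _)).
by rewrite ltn_pmul2r.
Qed.

Lemma induced_mono t t' x : (t <= t')%N -> SS t x -> SS t' x.
Proof.
move=> le_t [m [Nm ->]]; apply: induced_sum => b _; apply: induced_base => //.
by apply: leq_trans le_t; exact: bmdeg b.
Qed.

Lemma induced_dd i t a x : (mdeg a <= i)%N -> SS t x ->
  SS (t + i %/ q) (dd a *: x).
Proof.
move=> le_ai [m [Nm ->]]; rewrite scaler_sumr; apply: induced_sum => b _.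
rewrite scalerA divpartialmM scaler_algZ.
apply: inducedZ; apply: induced_divpartialm => //.
have le_bt : (mdeg (b : multinom n) <= t)%N := bmdeg b.
rewrite mdegD mdegMn mulSn mulnDl addnCA addnC -addnS leq_add ?leq_mul2r ?le_bt ?orbT //.
rewrite (leq_ltn_trans le_ai) // addnC {1}(divn_eq i q) ltn_add2l ltn_mod //.
Qed.

(** Moving [x_l] past [d^[q b]] costs at most a term [d^[q b - e_l]], of degree less than
    [(t + 1) q]; hence a variable does not raise the index. *)
Lemma induced_mulX1 t l x : SS t x -> SS t (mulX (mnm1 l) *: x).
Proof.
case: (hN) => _ _ NZ [m [Nm ->]]; rewrite scaler_sumr; apply: induced_sum => b _.
have le_bt : (mdeg (b : multinom n) <= t)%N := bmdeg b.
have -> : mulX (mnm1 l) *: (dd ((b : multinom n) *m+ q) *: m b) =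
    dd ((b : multinom n) *m+ q) *: (mulX (mnm1 l) *: m b) + (-1)%:A *:
    ((if (0 < ((b : multinom n) *m+ q) l)%N
      then dd ((b : multinom n) *m+ q -m mnm1 l) else 0) *: m b).
  by rewrite !scalerA divpartialm_mulX1 scaleN1r mulN1r -scalerDl addrK.
apply: inducedD.
  by apply: induced_base => //; apply: NZ => //; exact: level_mul.
apply: inducedZ; case: ifP => _; last by rewrite scale0r; exact: induced0.
apply: induced_divpartialm => //; apply: (leq_ltn_trans (mdegB _ _)).
by rewrite mdegMn ltn_pmul2r.
Qed.

(** Only divided powers raise the index, by at most [i %/ q]; this is behind the upper bound for the
    Hilbert function. *)
Lemma induced_cfilt i t u x : CF i u -> SS t x -> SS (t + i %/ q) (u *: x).
Proof.
move=> hu hx; move: u hu; apply: cfilt_ind; first by rewrite scale0r; exact: induced0.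
  move=> c u v hu hv; rewrite scalerDl scaler_algZ.
  by apply: inducedD => //; exact: inducedZ.
move=> a b le_i; rewrite -scalerA.
have : SS (t + i %/ q) (dd b *: x).
  by apply: induced_dd => //; apply: leq_trans le_i; exact: leq_addl.
elim/mnm_ind: a {le_i} => [|l a IH]; first by rewrite diffop_mulX0 scale1r.
by move=> /IH; rewrite diffop_mulXD -scalerA; exact: induced_mulX1.
Qed.

End Induced.

(** This is [induced_cfilt] for [D] as a module over itself, with [N = C_k] and the element [1].
    Allowing all [t' >= t] lets finitely many operators share one range. *)
Lemma level_cover (u : diffop K n) : exists t, forall t', (t <= t')%N ->
  exists m : multinom n -> diffop K n, (forall b, level (m b)) /\
    u = \sum_(b : bmultinom n t'.+1) dd (mnm_muln b q) * m b.
Proof.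
have hl : @level_submod (diffop K n)^o level.
  by split; [exact: level0|exact: levelD|exact: levelM].
have [i hi] := cfilt_exists hp u; exists (i %/ q)%N => t' le_t'.
apply: (@induced_mono (diffop K n)^o level hl (i %/ q)%N) => //.
rewrite -[u]mulr1; apply: (@induced_cfilt (diffop K n)^o level hl i 0 u 1 hi).
have mq0 : @mnm0 n *m+ q = @mnm0 n by apply/mnmP => l; rewrite mulmnE mnm0E.
have := @induced_base (diffop K n)^o level hl 0 (@mnm0 n) 1.
by rewrite mdeg0 mq0 divpartialm0 scale1r; apply=> //; exact: level1.
Qed.

End LevelModule.

(** * Descent of finitely presented modules *)

Section Descent.
Context (K : fieldType) (n p : nat) (hp : p \in [pchar K]).
Context (M : lmodType (diffop K n)).
Local Notation dd := (@divpartialm K n).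

(** These conditions say that [M] is induced from the [C_k]-module [N]: it is the direct sum of the
    copies [d^[q b] N] of [N]. *)
Record descent k (N : set M) : Prop := Descent {
  descent_submod : level_submod p k N;
  descent_cover : forall x, exists t, induced p k N t x;
  descent_free : forall d (m : multinom n -> M), (forall b, N (m b)) ->
    \sum_(b : bmultinom n d) dd (mnm_muln b (p ^ k)) *: m b = 0 ->
    forall b, (mdeg b < d)%N -> m b = 0 }.

(* The presentation involves finitely many operators, hence is defined over
   the operators of some level [k]. *)
Lemma finitely_presented_descent : finitely_presented M ->
  exists k (N : set M), descent k N.
Proof.
move=> [r [g [gen [l [s rel]]]]].
have [k ks] : exists k, forall j i, @level K n p k (s j i).
  have /choice[f fP] := fun ji : 'I_l * 'I_r => level_exists hp (s ji.1 ji.2).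
  exists (\max_ji f ji)%N => j i.
  by apply: level_le (fP (j, i)); exact: (leq_bigmax (F := f)).
pose N : set M := [set x | exists u : 'I_r -> diffop K n,
  (forall i, @level K n p k (u i)) /\ x = \sum_i u i *: g i]%classic.
have hN : level_submod p k N.
  split.
  - exists (fun=> 0); split=> [i|]; first exact: level0.
    by rewrite big1 // => i _; rewrite scale0r.
  - move=> x y [u [hu ->]] [v [hv ->]]; exists (fun i => u i + v i).
    split=> [i|]; first exact: levelD.
    by rewrite -big_split; apply: eq_bigr => i _; rewrite /= scalerDl.
  - move=> w x hw [u [hu ->]]; exists (fun i => w * u i).
    split=> [i|]; first exact: levelM.
    by rewrite scaler_sumr; apply: eq_bigr => i _; rewrite scalerA.
exists k, N; split=> //.
  move=> x; have [c ->] := gen x.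
  have Ng i : N (g i).
    exists (fun j => (j == i)%:R); split=> [j|].
      by case: eqP => _; [exact: level1|exact: level0].
    rewrite (bigD1 i) //= eqxx scale1r big1 ?addr0 // => j /negbTE->.
    by rewrite scale0r.
  have /choice[t tP] := fun i => cfilt_exists hp (c i).
  exists (\max_i (t i %/ p ^ k))%N; apply: (induced_sum hN) => i _.
  apply: (@induced_mono _ _ _ k M N hN (t i %/ p ^ k)%N); first exact: leq_bigmax.
  apply: (@induced_cfilt _ _ _ hp k M N hN (t i) 0 (c i) (g i) (tP i)).
  have mq0 : @mnm0 n *m+ (p ^ k) = @mnm0 n by apply/mnmP => j; rewrite mulmnE mnm0E.
  have := @induced_base _ _ p k M N hN 0 (@mnm0 n) (g i).
  by rewrite mdeg0 mq0 divpartialm0 scale1r; exact.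
move=> d m /choice[u uP] m0.
(* Lifting the [m b] to coefficients on the generators turns the vanishing sum into a relation [w],
   which the presentation expresses through the [s j]. *)
pose w i := \sum_(b : bmultinom n d) dd (mnm_muln b (p ^ k)) * u b i.
have /rel[c wc] : \sum_i w i *: g i = 0.
  rewrite -[RHS]m0; under eq_bigr do rewrite scaler_suml.
  rewrite exchange_big; apply: eq_bigr => b _ /=.
  rewrite [in RHS](uP b).2 scaler_sumr.
  by apply: eq_bigr => i _; rewrite scalerA.
have /choice[t tP] := fun j => level_cover hp k (c j).
pose e := maxn d (\max_j t j)%N.
have /choice[C CP] j := tP j e (leq_trans (leq_bigmax j) (leq_maxr _ _)).
have le_de : (d <= e.+1)%N by rewrite ltnW // ltnS leq_maxl.
pose U b i := if (mdeg b < d)%N then u b i else 0.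
(* Since the [s j i] have level [k], both expressions for [w i] are expansions in the [d^[q b]] with
   coefficients of level [k], and freeness of [D] lets these be compared. *)
have UC i : forall b, (mdeg b < e.+1)%N -> U b i - \sum_j C j b * s j i = 0.
  apply: (level_free hp (k := k)).
    move=> b; apply: levelB.
      by rewrite /U; case: ifP => _; [exact: (uP b).1|exact: level0].
    by apply: level_sum => j; apply: levelM; [exact: (CP j).1|exact: ks].
  transitivity (w i - \sum_j c j * s j i); last by rewrite wc subrr.
  rewrite /w (big_bmultinom_widen (fun b => dd (b *m+ (p ^ k)) * u b i) le_de).
  rewrite [X in _ = X - _]big_mkcond.
  have -> : \sum_j c j * s j i = \sum_(b : bmultinom n e.+1) \sum_j
      dd (mnm_muln b (p ^ k)) * (C j b * s j i).
    rewrite exchange_big; apply: eq_bigr => j _; rewrite {1}(CP j).2 mulr_suml.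
    by apply: eq_bigr => b _; rewrite mulrA.
    rewrite -sumrB; apply: eq_bigr => b _; rewrite mulrBr mulr_sumr; congr (_ - _).
  by rewrite /U; case: ifP => _; rewrite ?mulr0.
(* Each row [s j] is itself a relation among the generators, so [m b], given by a combination of
   these rows, is zero. *)
have sg j : \sum_i s j i *: g i = 0.
  apply/rel; exists (fun j' => (j' == j)%:R) => i.
  by rewrite (bigD1 j) //= eqxx mul1r big1 ?addr0 // => j' /negbTE->; rewrite mul0r.
move=> b ltb; rewrite (uP b).2.
have uE i : u b i = \sum_j C j b * s j i.
  by apply/subr0_eq; have := UC i b (leq_trans ltb le_de); rewrite /U ltb.
under eq_bigr do rewrite uE scaler_suml.
rewrite exchange_big big1 //= => j _; under eq_bigr do rewrite -scalerA.
by rewrite -scaler_sumr sg scaler0.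
Qed.

End Descent.

(** * Counting multi-indices *)

Lemma leq_exp2rW m n e : (m <= n)%N -> (m ^ e <= n ^ e)%N.
Proof. by case: e => // e; rewrite leq_exp2r. Qed.

Lemma card_bmultinom n t : #|{: bmultinom n t.+1}| = 'C(t + n, n).
Proof.
rewrite addnC -card_partial_ord_partitions.
pose f (b : bmultinom n t.+1) : n.-tuple 'I_t.+1 :=
  mktuple (fun i => inord ((b : multinom n) i)).
have le_bt (b : bmultinom n t.+1) i : ((b : multinom n) i <= t)%N.
  by rewrite -ltnS (leq_ltn_trans _ (bmdeg b)) // mdegE (bigD1 i) //= leq_addr.
have fE (b : bmultinom n t.+1) i : tnth (f b) i = (b : multinom n) i :> nat.
  by rewrite tnth_mktuple inordK // ltnS le_bt.
have f_inj : injective f.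
  by move=> b b' ff; apply/val_inj/mnmP => i; rewrite -!fE ff.
rewrite -(card_imset predT f_inj); apply: eq_card => x; rewrite !inE.
apply/imsetP/idP => [[b _ ->]|le_xt].
  rewrite big_tuple (eq_bigr (fun i => (b : multinom n) i)) => [|i _]; last exact: fE.
  by rewrite -mdegE -ltnS bmdeg.
pose m := Multinom (mktuple (fun i => val (tnth x i))).
have lt_m : (mdeg m < t.+1)%N.
  rewrite ltnS; move: le_xt; rewrite big_tuple mdegE.
  by under [X in _ -> (X <= _)%N]eq_bigr do rewrite mnmE.
exists (BMultinom lt_m) => //; apply: eq_from_tnth => i; apply: ord_inj.
by rewrite fE mnmE.
Qed.

(** [n! C(t+n, n)] is the product of the [n] factors [t+n, ..., t+1], each between [t] and [t + n];
    this gives both estimates. *)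
Lemma fact_mul_bin_ge n t : (t ^ n <= n`! * 'C(t + n, n))%N.
Proof.
rewrite mulnC bin_ffact ffact_prod.
have -> : (t ^ n = \prod_(i < n) t)%N by rewrite prod_nat_const card_ord.
by apply: leq_prod => i _; rewrite -addnBA ?leq_addr // ltnW.
Qed.

Lemma fact_mul_bin_le n t : (n`! * 'C(t + n, n) <= (t + n) ^ n)%N.
Proof.
rewrite mulnC bin_ffact ffact_prod.
have -> : ((t + n) ^ n = \prod_(i < n) (t + n))%N by rewrite prod_nat_const card_ord.
by apply: leq_prod => i _; exact: leq_subr.
Qed.

(** * Spans and the canonical filtration *)

Section KspanClosure.
Context (K : fieldType) (n : nat) (M : lmodType (diffop K n)).
Local Notation CF := (@canonical_filtration K n).

Lemma Kspan0 (I : finType) (w : I -> M) : Kspan w 0.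
Proof. by exists (fun=> 0); rewrite big1 // => i _; rewrite !scale0r. Qed.

Lemma KspanD (I : finType) (w : I -> M) x y : Kspan w x -> Kspan w y -> Kspan w (x + y).
Proof.
move=> [c ->] [d ->]; exists (fun i => c i + d i); rewrite -big_split.
by apply: eq_bigr => i _; rewrite /= -scalerDl -scalerDl.
Qed.

Lemma KspanZ (I : finType) (w : I -> M) (a : K) x : Kspan w x -> Kspan w (a%:A *: x).
Proof.
move=> [c ->]; exists (fun i => a * c i); rewrite scaler_sumr.
by apply: eq_bigr => i _; rewrite scaler_algM.
Qed.

Lemma Kspan_sum (J : Type) (s : seq J) (F : J -> M) (I : finType) (w : I -> M) :
  (forall j, Kspan w (F j)) -> Kspan w (\sum_(j <- s) F j).
Proof. by move=> hF; apply: big_ind => //; [exact: Kspan0|exact: KspanD]. Qed.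

(** A relation after adjoining [x] must have a nonzero coefficient at [x], as [v] is free, and can
    be solved for [x]. *)
Lemma Kspan_maximal r (v : 'I_r -> M) x : Kfree v ->
  ~ Kfree (fun i => if unlift ord0 i is Some j then v j else x) -> Kspan v x.
Proof.
move=> fv /existsNP[c /not_implyP[]]; rewrite big_ord_recl unlift_none.
under eq_bigr do rewrite liftK.
have [c0|c0] := eqVneq (c ord0) 0.
  rewrite c0 scale0r scale0r add0r => /fv cl /existsNP[i].
  by case: (unliftP ord0 i) => [j ->|->].
move=> /eqP; rewrite addr_eq0 => /eqP xE _.
exists (fun j => - ((c ord0)^-1 * c (lift ord0 j))).
under eq_bigr do rewrite scaleNr scaleNr -scaler_algM.
by rewrite sumrN -scaler_sumr -scalerN -xE scaler_algM mulVf // !scale1r.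
Qed.

Lemma act_set_cfiltM i j (V : set M) u x :
  CF i u -> act_set (CF j) V x -> act_set (CF (i + j)) V (u *: x).
Proof.
move=> hu [k [a [v [ha hv ->]]]]; exists k, (fun l => u * a l), v.
split=> // [l|]; first exact: cfiltM.
by rewrite scaler_sumr; apply: eq_bigr => l _; rewrite scalerA.
Qed.

Lemma act_set_cfilt_le i j (V : set M) : (i <= j)%N ->
  (act_set (CF i) V `<=` act_set (CF j) V)%classic.
Proof.
move=> le_ij x [k [a [v [ha hv ->]]]]; exists k, a, v; split=> // l.
exact: (cfilt_le le_ij).
Qed.

Lemma act_set_cfilt_Kspan i (V : set M) d : has_Kdim V d ->
  exists (I : finType) (w : I -> M), act_set (CF i) V = Kspan w.
Proof.
move=> [g [_ VE]].
(* The index set is a full product; pairs of total degree above [i] are given the zero vector. *)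
pose I : finType := ((bmultinom n i.+1 * bmultinom n i.+1) * 'I_d)%type.
pose ok (x : I) := (mdeg (x.1.1 : multinom n) + mdeg (x.1.2 : multinom n) <= i)%N.
pose op (x : I) := diffop_mul (mpolyX K x.1.1) * @divpartialm K n x.1.2.
exists I, (fun x => if ok x then op x *: g x.2 else 0).
have Vg j : V (g j) by rewrite VE; have [c gc] := Kspan_mem g j; exists c.
apply/seteqP; split=> [x [k [a [v [ha hv ->]]]]|x [c ->]].
  apply: Kspan_sum => l; have := hv l; rewrite VE => -[c _ <-].
  rewrite scaler_sumr; apply: Kspan_sum => j; rewrite scalerA_comm; apply: KspanZ.
  move: (a l) (ha l); apply: cfilt_ind; first by rewrite scale0r; exact: Kspan0.
    move=> y u u' hu hu'; rewrite scalerDl scaler_algZ.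
    by apply: KspanD => //; exact: KspanZ.
  move=> b b' le_i.
  have lt_b : (mdeg b < i.+1)%N by rewrite ltnS (leq_trans _ le_i) ?leq_addr.
  have lt_b' : (mdeg b' < i.+1)%N by rewrite ltnS (leq_trans _ le_i) ?leq_addl.
  have := Kspan_mem (fun x => if ok x then op x *: g x.2 else 0)
    ((BMultinom lt_b, BMultinom lt_b'), j).
  by rewrite /= /ok /op /= le_i.
exists #|I|, (fun l => if ok (enum_val l) then c (enum_val l) *: op (enum_val l) else 0).
exists (fun l => g (enum_val l).2); split=> // [l|].
  case: ifP => okl; last exact: cfilt0.
  by apply/cfiltZ/cfilt_mono.
rewrite [RHS](reindex (@enum_rank I)) /=; last first.
  by exists enum_val => l _; [exact: enum_rankK|exact: enum_valK].
apply: eq_bigr => l _; rewrite enum_rankK; case: ifP => _.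
  by rewrite [RHS]scaler_algZ.
by rewrite scaler0 scale0r.
Qed.

End KspanClosure.

(** * Growth of the canonical filtration *)

Section HilbertBounds.
Context (K : fieldType) (n p : nat) (hp : p \in [pchar K]).
Context (M : lmodType (diffop K n)) (k : nat) (N : set M) (hN : descent p k N).
Local Notation q := (p ^ k)%N.
Local Notation mulX m := (diffop_mul (mpolyX K m)).
Local Notation dd := (@divpartialm K n).
Local Notation CF := (@canonical_filtration K n).

Let q_gt0 : (0 < q)%N. Proof. exact: pchar_exp_gt0 hp. Qed.

(* The space whose induced module is [M] in the equivalence given by
   Frobenius descent. *)
Definition core : set M := [set x | N x /\ mproj K p k (@mnm0 n) *: x = x]%classic.

Definition core_index r t : finType :=
  (bmultinom n t.+1 * ({ffun 'I_n -> 'I_q} * 'I_r))%type.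

Definition core_family r t (v : 'I_r -> M) (x : core_index r t) : M :=
  dd (mnm_muln x.1 q) *: (mulX (mexp x.2.1) *: v x.2.2).

Lemma card_core_index r t : #|core_index r t| = ('C(t + n, n) * (q ^ n * r))%N.
Proof. by rewrite !card_prod card_bmultinom card_ffun !card_ord. Qed.

Lemma big_core_index r t (F : core_index r t -> M) :
  \sum_x F x = \sum_b \sum_e \sum_j F (b, (e, j)).
Proof.
transitivity (\sum_b \sum_ej F (b, ej)).
  by rewrite pair_bigA; apply: eq_bigr => -[].
by apply: eq_bigr => b _; rewrite pair_bigA; apply: eq_bigr => -[].
Qed.

(** Freeness over the [d^[q b]] leaves a relation among the [x^e v_j] for each [b]; as
    [v_j = mproj 0 v_j], applying [mproj (mexp e)] isolates one [e] by the rule for matrix units. *)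
Lemma core_family_free r t (v : 'I_r -> M) : (forall j, core (v j)) -> Kfree v ->
  Kfree (core_family (t := t) v).
Proof.
have [[N0 ND NZ] _ Nfree] := hN.
move=> hv fv c; pose C b e j := c (b, (e, j)).
(* [descent_free] takes a function on all multi-indices, so [insubd] extends the coefficients;
   within the range [valKd] recovers the given ones. *)
pose m b := \sum_e \sum_j (C (insubd (@bm0 n t) b) e j)%:A *: (mulX (mexp e) *: v j).
move=> c0; have m0 : \sum_(b : bmultinom n t.+1) dd (mnm_muln b q) *: m b = 0.
  rewrite -[RHS]c0.
  rewrite big_core_index; apply: eq_bigr => b _.
  rewrite scaler_sumr; apply: eq_bigr => e _; rewrite scaler_sumr; apply: eq_bigr => j _.
  by rewrite scalerA_comm valKd.
have Nm b : N (m b).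
  apply: big_ind => // e _; apply: big_ind => // j _.
  apply: (NZ); first exact/levelZ/level1.
  by apply: NZ; [exact: level_mul|exact: (hv j).1].
move=> [b [e j]]; have := Nfree _ _ Nm m0 b (bmdeg b); rewrite /m valKd.
move/(congr1 (fun x => mproj K p k (mexp e) *: x)); rewrite scaler0 scaler_sumr.
rewrite (bigD1 e) //= [X in _ + X]big1 ?addr0 => [|e' ne_e].
  rewrite scaler_sumr => S0; apply: (fv (fun j => C b e j)); rewrite -[RHS]S0.
  apply: eq_bigr => j' _; rewrite -[in RHS](hv j').2 scalerA_comm !scalerA.
  rewrite -[mproj K p k _ * _ * _]mulrA (mproj_mulX_mproj0 hp) ?eqxx ?scale1r;
    try exact: mexp_lt.
  by rewrite -scalerA (hv j').2.
rewrite scaler_sumr big1 // => j' _; rewrite -[v j'](hv j').2 scalerA_comm !scalerA.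
rewrite -[mproj K p k _ * _ * _]mulrA (mproj_mulX_mproj0 hp); try exact: mexp_lt.
by rewrite (inj_eq (@mexp_inj _ _ _)) eq_sym (negbTE ne_e) scale0r mulr0 scale0r.
Qed.

(** The expansion of [1] as the sum of the [x^e mproj e] splits each [m b], and
    [mproj 0 * mproj e = mproj e] puts [mproj e *: m b] into the core. *)
Lemma core_family_span r t (v : 'I_r -> M) x : (core `<=` Kspan v)%classic ->
  induced p k N t x -> Kspan (core_family (t := t) v) x.
Proof.
have [[N0 ND NZ] _ _] := hN.
move=> cv [m [Nm ->]]; apply: Kspan_sum => b; have {}Nm := Nm b.
rewrite -[m b]scale1r (level_expand hp (k := k) (u := 1)); last exact: level1.
rewrite scaler_suml scaler_sumr; apply: Kspan_sum => e.
have : core (mproj K p k (mexp e) *: m b).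
  split; first by apply: NZ => //; exact: level_mproj.
  by rewrite scalerA mproj0_mproj // => l; exact: mexp_lt.
move=> /cv[c cE]; rewrite -(scalerA _ (mproj K p k (mexp e))) cE !scaler_sumr.
apply: Kspan_sum => j.
by rewrite !scalerA_comm; apply: KspanZ; exact: (Kspan_mem (core_family v) (b, (e, j))).
Qed.

Lemma generating_cfilt (V : set M) x : generating_space V ->
  exists c, act_set (CF c) V x.
Proof.
move=> [_ Vgen]; have : act_set setT V x by rewrite Vgen.
move=> [l [a [v [_ hv ->]]]]; have /choice[c ca] := fun j => cfilt_exists hp (a j).
exists (\max_j c j)%N, l, a, v; split=> // j.
by apply: cfilt_le (ca j); exact: leq_bigmax.
Qed.

Lemma hilbert_lower r (v : 'I_r -> M) (V : set M) : generating_space V ->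
  (forall j, core (v j)) -> Kfree v ->
  exists c, forall i, (c <= i)%N -> (r * (i - c) ^ n <= n`! * hilbert V i)%N.
Proof.
move=> gV hv fv; have [[d Vd] _] := gV.
have /choice[c0 hc0] := fun j => generating_cfilt (v j) gV.
(* Here [n q] bounds the degree of every [x^e], [c0 j] is a step of the filtration reaching [v j],
   and the extra [q] absorbs the rounding in [t]. *)
pose c := (\max_j c0 j + n * q)%N; exists (c + q)%N => i le_ci.
pose t := ((i - c) %/ q)%N.
have le_t : (q ^ n * r * 'C(t + n, n) <= hilbert V i)%N.
  have [I [w wE]] := act_set_cfilt_Kspan i Vd.
  rewrite mulnC -card_core_index /hilbert wE.
  apply: (Kdim_Kspan_ge (core_family_free hv fv)).
  move=> [b [e j]]; rewrite -wE /core_family /=.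
  have le_bt : (mdeg (b : multinom n) <= t)%N := bmdeg b.
  have le_e : (mdeg (mexp e) <= n * q)%N.
    rewrite mdegE -[X in (_ <= X * _)%N]card_ord -sum_nat_const.
    by apply: leq_sum => l _; rewrite ltnW // mexp_lt.
  apply: (act_set_cfilt_le (i := t * q + (n * q + c0 j))).
    have := leq_bigmax (F := c0) j; have := leq_divM (i - c) q; rewrite -/t.
    by move: le_ci; rewrite /c; lia.
  apply: act_set_cfiltM.
    by apply: (cfilt_le _ (cfilt_dd _ _)); rewrite mdegMn leq_mul2r le_bt orbT.
  by apply: act_set_cfiltM => //; apply: (cfilt_le le_e); exact: cfilt_X.
apply: leq_trans (leq_mul (leqnn n`!) le_t).
rewrite -[X in (_ <= X)%N](_ : r * (q ^ n * (n`! * 'C(t + n, n))) = _)%N; last by lia.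
apply: leq_mul => //; apply: leq_trans (leq_mul (leqnn _) (fact_mul_bin_ge n t)).
rewrite -expnMn; apply: leq_exp2rW.
have := ltn_ceil (i - c) q_gt0; rewrite -/t; lia.
Qed.

Lemma hilbert_upper r (v : 'I_r -> M) (V : set M) : generating_space V ->
  (core `<=` Kspan v)%classic ->
  exists c, forall i, (n`! * hilbert V i <= r * (i + c) ^ n)%N.
Proof.
have [N_sub Ncover _] := hN.
move=> gV cv; have [[d Vd] _] := gV; have [g [_ VE]] := Vd.
have /choice[t0 ht0] := fun j => Ncover (g j).
(* All of [F_i V] lies in step [t = s + i %/ q] of the induced filtration, and
   [q (t + n) <= i + s q + n q] explains the constant. *)
pose s := (\max_j t0 j)%N; exists (s * q + n * q)%N => i.
pose t := (s + i %/ q)%N.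
have le_t : (hilbert V i <= q ^ n * r * 'C(t + n, n))%N.
  have [I [w wE]] := act_set_cfilt_Kspan i Vd.
  rewrite mulnC -card_core_index /hilbert wE; apply: (Kdim_Kspan_le (w := core_family v)).
  move=> x; have : act_set (CF i) V (w x) by rewrite wE; exact: Kspan_mem.
  move=> [l [a [y [ha hy ->]]]]; apply: core_family_span => //.
  apply: (induced_sum N_sub) => j _; apply: (induced_cfilt hp N_sub) => //.
  have := hy j; rewrite VE => -[c _ <-]; apply: (induced_sum N_sub) => b _.
  apply: (inducedZ N_sub); apply: (induced_mono N_sub _ (ht0 b)).
  exact: leq_bigmax.
apply: leq_trans (leq_mul (leqnn n`!) le_t) _.
rewrite [X in (X <= _)%N](_ : _ = r * (q ^ n * (n`! * 'C(t + n, n))))%N; last by lia.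
apply: leq_mul => //; apply: leq_trans (leq_mul (leqnn _) (fact_mul_bin_le n t)) _.
rewrite -expnMn; apply: leq_exp2rW.
rewrite /t mulnDr mulnDr; have := leq_divM i q; lia.
Qed.

End HilbertBounds.

(** * Finite dimension of the core *)

Section Multiplicity.
Context (K : fieldType) (n p : nat) (hp : p \in [pchar K]).
Context (M : lmodType (diffop K n)) (k : nat) (N : set M) (hN : descent p k N).

(** A natural number above the sum of the absolute values of the coefficients works, since
    [i^j <= i^n] for [i > 0] and [j <= n]. *)
Lemma poly_rat_ub (s : {poly rat}) : size s = n.+1 ->
  exists C : nat, forall i : nat, (0 < i)%N -> s.[i%:R] <= (C * i ^ n)%:R.
Proof.
move=> sz; pose x := \sum_(j < n.+1) `|s`_j|.
have x_ge0 : 0 <= x by apply: sumr_ge0.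
exists (Num.bound x) => i i_gt0; rewrite horner_coef sz natrM natrX.
apply: (@le_trans _ _ (x * i%:R ^+ n)); last first.
  by apply: ler_wpM2r; [exact/exprn_ge0/ler0n|exact/ltW/archi_boundP].
rewrite mulr_suml; apply: ler_sum => j _.
apply: le_trans (ler_norm _) _; rewrite normrM normrX normr_nat.
apply: ler_wpM2l => //; apply: ler_weXn2l; first by rewrite ler1n.
by rewrite -ltnS.
Qed.

Lemma holonomic_hilbert_le : holonomic M -> exists (V : set M) (C n0 : nat),
  generating_space V /\ forall i, (n0 <= i)%N -> (hilbert V i <= C * i ^ n)%N.
Proof.
move=> [_ [V [gV [s [sz [n0 _ hs]]]]]]; have [C sC] := poly_rat_ub sz.
exists V, C, n0.+1; split=> // i lt_i; rewrite -(ler_nat rat).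
exact: le_trans (hs i (ltnW lt_i)) (sC i (leq_ltn_trans (leq0n _) lt_i)).
Qed.

(** A free family of size [r] in the core forces growth of order at least [r i^n / n!], whereas
    holonomicity allows at most [C i^n]. *)
Lemma core_rank_bounded : holonomic M -> exists B : nat,
  forall r (v : 'I_r -> M), (forall j, core p k N (v j)) -> Kfree v -> (r <= B)%N.
Proof.
move=> /holonomic_hilbert_le[V [C [n0 [gV hV]]]]; exists (n`! * C * 2 ^ n)%N => r v cv fv.
have [c hc] := hilbert_lower hp hN gV cv fv.
(* At [i = 2 j] one has [i - c >= j], so the two bounds give [r j^n <= n! C 2^n j^n]. *)
pose j := (n0 + c).+1; have h1 := hc (j * 2)%N; have h2 := hV (j * 2)%N.
have j_gt0 : (0 < j ^ n)%N by rewrite expn_gt0.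
rewrite -(leq_pmul2r j_gt0) -mulnA -expnMn mulnC.
rewrite -[in X in (_ <= X)%N]mulnA [(2 * j)%N]mulnC.
apply: leq_trans (leq_mul (leqnn n`!) (h2 _)); last by rewrite /j; lia.
rewrite mulnC; apply: leq_trans (h1 _); last by rewrite /j; lia.
by apply: leq_mul => //; apply: leq_exp2rW; rewrite /j; lia.
Qed.

(** A free family of maximal length exists by the bound on the rank, and maximality makes it
    spanning. *)
Lemma core_basis : holonomic M -> exists r (v : 'I_r -> M),
  [/\ forall j, core p k N (v j), Kfree v & (core p k N `<=` Kspan v)%classic].
Proof.
move=> /core_rank_bounded[B hB].
pose P r := `[< exists v : 'I_r -> M, (forall j, core p k N (v j)) /\ Kfree v >].
have exP : exists r, P r.
  exists 0%N; apply/asboolP; exists (fun=> 0); split=> [[]//|c _ []//].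
have ubP r : P r -> (r <= B)%N by move=> /asboolP[v []]; exact: hB.
case: (ex_maxnP exP ubP) => r /asboolP[v [cv fv]] maxr; exists r, v; split=> // x cx.
apply: (Kspan_maximal fv) => fvx; have := maxr r.+1; rewrite ltnn.
suff -> : P r.+1 by move/(_ isT).
apply/asboolP; exists (fun i => if unlift ord0 i is Some j then v j else x); split=> // i.
by case: unlift.
Qed.

End Multiplicity.

(** * From two-sided bounds to the multiplicity *)

(** The difference of the [n]-th powers is [2 c] times a sum of [n] products of degree [n - 1],
    whose factors are at most [2 i] because [c <= i]. *)
Lemma leq_expnD_expnB n c i : (c <= i)%N ->
  ((i + c) ^ n <= (i - c) ^ n + 2 * c * n * 2 ^ n.-1 * i ^ n.-1)%N.
Proof.
move=> le_ci; rewrite -leq_subLR subn_exp.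
have -> : (i + c - (i - c) = 2 * c)%N by lia.
rewrite -!mulnA leq_mul2l; apply/orP; right.
rewrite leq_mul2l -expnMn; apply/orP; right.
rewrite -[X in (_ <= X * _)%N]card_ord -sum_nat_const; apply: leq_sum => j _.
have nE : (n.-1 - j + j = n.-1)%N by rewrite subnK // -ltnS (ltn_predK (ltn_ord j)).
have le1 : (i + c <= 2 * i)%N by lia.
have le2 : (i - c <= 2 * i)%N by lia.
apply: leq_trans (leq_mul (leq_exp2rW _ le1) (leq_exp2rW _ le2)) _.
by rewrite -expnD nE.
Qed.

(** The error [A i^(n-1)] is at most [eps n! i^n] once [i >= A / (eps n!)], since
    [i^n = i * i^(n-1)] for [n > 0]. *)
Lemma is_multiplicity_of_bounds (R : realType) (K : fieldType) (n : nat)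
    (M : lmodType (diffop K n)) (r : nat) : (0 < n)%N ->
  (forall V : set M, generating_space V -> exists A c : nat, forall i, (c <= i)%N ->
    (n`! * hilbert V i <= r * i ^ n + A * i ^ n.-1)%N /\
    (r * i ^ n <= n`! * hilbert V i + A * i ^ n.-1)%N) ->
  is_multiplicity M (r%:R : R).
Proof.
move=> n_gt0 hM V /hM[A [c hA]]; apply/eqoP => eps eps_gt0.
have f_gt0 : 0 < n`!%:R :> R by rewrite ltr0n fact_gt0.
have A_ge0 : 0 <= A%:R / (eps * n`!%:R) :> R.
  by rewrite divr_ge0 ?ler0n // ltW // mulr_gt0.
exists (maxn c (Num.bound (A%:R / (eps * n`!%:R) : R))) => // i /=.
rewrite geq_max => /andP[le_ci le_i]; have [h1 h2] := hA i le_ci.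
have le_A : A%:R <= eps * n`!%:R * i%:R.
  rewrite mulrC -ler_pdivrMr ?mulr_gt0 //; apply: le_trans (ltW (archi_boundP A_ge0)) _.
  by rewrite ler_nat.
have le_Ai : (A * i ^ n.-1)%:R <= eps * n`!%:R * i%:R ^+ n :> R.
  have -> : i%:R ^+ n = i%:R * i%:R ^+ n.-1 :> R by rewrite -exprS prednK.
  by rewrite natrM natrX mulrA ler_wpM2r // exprn_ge0 // ler0n.
rewrite -(ler_pM2l f_gt0) -{1}[n`!%:R](gtr0_norm f_gt0) -normrM.
rewrite [X in _ <= X]mulrCA mulrA normrX normr_nat.
have -> : n`!%:R * ((hilbert V i)%:R - r%:R / n`!%:R * i%:R ^+ n) =
    (n`! * hilbert V i)%:R - (r * i ^ n)%:R :> R.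
  by rewrite mulrBr !natrM natrX mulrA mulrCA divff ?mulr1 // gt_eqF.
apply: le_trans le_Ai; rewrite ler_distl lerBlDr -!natrD !ler_nat.
by rewrite h1 h2.
Qed.
Theorem theorem8p7 (R : realType) (K : fieldType) (p n : nat)
  (hp : p \in [pchar K]) (hn : (0 < n)%N)
  (M : lmodType (diffop K n)) (hol : holonomic M) (fp : finitely_presented M) :
  exists m : nat, is_multiplicity M (m%:R : R).
Proof.
have [k [N hN]] := finitely_presented_descent hp fp.
have [r [v [cv fv vc]]] := core_basis hp hN hol.
exists r; apply: is_multiplicity_of_bounds => // V gV.
have [c1 h1] := hilbert_lower hp hN gV cv fv.
have [c2 h2] := hilbert_upper hp hN gV vc.
(* Both [n! * hilbert V i] and [r i^n] lie between [r (i - c)^n] and [r (i + c)^n]; the error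
   constant is [r] times the one in [leq_expnD_expnB]. *)
pose c := maxn c1 c2; exists (r * (2 * c * n * 2 ^ n.-1))%N, c => i le_ci.
have hc := leq_mul (leqnn r) (leq_expnD_expnB n le_ci).
have lo : (r * (i - c) ^ n <= n`! * hilbert V i)%N.
  apply: leq_trans (h1 i (leq_trans (leq_maxl _ _) le_ci)).
  by rewrite leq_mul // leq_exp2rW // leq_sub2l // leq_maxl.
have up : (n`! * hilbert V i <= r * (i + c) ^ n)%N.
  apply: leq_trans (h2 i) _.
  by rewrite leq_mul // leq_exp2rW // leq_add2l leq_maxr.
have mi1 : (r * (i - c) ^ n <= r * i ^ n)%N by rewrite leq_mul // leq_exp2rW // leq_subr.
have mi2 : (r * i ^ n <= r * (i + c) ^ n)%N by rewrite leq_mul // leq_exp2rW // leq_addr.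
rewrite mulnDr mulnA in hc; split; lia.
Qed.
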